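(* Let $(\widehat{\mathcal P}^{{\rm ag},\bullet}_+,\widehat{\mathcal P}^{{\rm ag},\bullet}_-)$ denote the estimated communities obtained by applying $k$-means clustering with $k=2$ ($\bullet={\rm km}$) or mean threshold clustering ($\bullet={\rm mt}$) to the vector $\widehat\sigma^{\rm ag}$. Then there exist an integer $N_0$ and positive constants $K_1$ and $K_2$ depending only on $\lambda,p,r_+$ such that $$\mathbb P\left((\widehat{\mathcal P}^{{\rm ag},\bullet}_+,\widehat{\mathcal P}^{{\rm ag},\bullet}_-)\ne(\mathcal P_+,\mathcal P_-)\right)\le K_2\left(\frac1N+\frac1T\right)$$ for all $(N,T)$ such that $N\ge N_0$ and $T\ge K_1N^2\log^2(TN)$.
   Context: Model. Fix $0<\lambda<1$, $0<\mu\le\lambda$, $0<p\le 1$ and $r_+,r_-\in(0,1)$ with $r_++r_-=1$. For each $N$, $[N]=\{1,\dots,N\}$ is partitioned into two deterministic sets $\mathcal P_+,\mathcal P_-$; with $r^N_a=|\mathcal P_a|/N$ ($a\in\{-,+\}$) it is assumed that $|r^N_+-r_+|\vee|r^N_--r_-|\le K_0N^{-1}$ for a fixed constant $K_0$ (regarded as absolute). Let $\theta=(\theta_{ij})_{i,j\in[N]}$ be i.i.d. $\mathrm{Ber}(p)$. Conditionally on $\theta$, $X=(X_t)_{t\in\mathbb Z}$, $X_t=(X_{1,t},\dots,X_{N,t})\in\{0,1\}^N$, is the (unique in law) stationary Markov chain such that, given $X_{t-1}=x$, the coordinates of $X_t$ are independent with $X_{i,t}\sim\mathrm{Ber}(p_{\theta,i}(x))$,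 where $$p_{\theta,i}(x)=\mu+(1-\lambda)\Big(\frac1N\sum_{j\in\mathcal P_+}\theta_{ij}x_j+\frac1N\sum_{j\in\mathcal P_-}\theta_{ij}(1-x_j)\Big).$$ $\mathbb P$ refers to the joint law of $(\theta,X)$. Estimators. The sample is $X_1,\dots,X_{T+1}$, $T\ge1$ an integer. $1_N\in\mathbb R^N$ is the all-ones vector. $\widehat m=\frac1T\sum_{t=1}^TX_t$, $\widehat\Sigma^{(1)}=\frac1T\sum_{t=1}^T(X_{t+1}-\widehat m)(X_t-\widehat m)^\top$, $\widehat\sigma^{\rm ag}=(\widehat\Sigma^{(1)})^\top1_N$. $k$-means clustering: $(\widehat{\mathcal P}^{\rm ag,km}_+,\widehat{\mathcal P}^{\rm ag,km}_-)$ is a partition of $[N]$ into two nonempty sets that is a global minimizer over partitions $(S,S^c)$ of $\sum_{i\in S}(\widehat\sigma^{\rm ag}_i-\widehat\mu_S)^2+\sum_{i\in S^c}(\widehat\sigma^{\rm ag}_i-\widehat\mu_{S^c})^2$, with $\widehat\mu_V=|V|^{-1}\sum_{i\in V}\widehat\sigma_i^{\rm ag}$; the label $+$ is given to the cluster with the larger mean. Mean threshold clustering: $\widehat{\mathcal P}^{\rm ag,mt}_+=\{i\in[N]:\widehat\sigma^{\rm ag}_i\ge N^{-1}\sum_{j=1}^N\widehat\sigma^{\rm ag}_j\}$ and $\widehat{\mathcal P}^{\rm ag,mt}_-=[N]\setminus\widehat{\mathcal P}^{\rm ag,mt}_+$. *)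

(* Defs.v *)
From HB Require Import structures.
From mathcomp Require Export all_boot all_order all_algebra.
From mathcomp Require Export all_classical all_reals all_analysis.

Set Implicit Arguments.
Unset Strict Implicit.
Unset Printing Implicit Defensive.
Import Order.TTheory GRing.Theory Num.Theory.
Local Open Scope classical_set_scope.
Local Open Scope ring_scope.

(* Throughout, the components are indexed by 'I_N instead of {1, ..., N}, and a
   partition of them into two sets is the pair (Pp, ~: Pp). *)

Section model.
Context {R : realType} {N : nat}.
Implicit Types (t : 'M[bool]_N) (x y : {ffun 'I_N -> bool}) (Pp : {set 'I_N}).

Definition spike_prob (lambda mu : R) Pp t x (i : 'I_N) : R :=
  mu + (1 - lambda) *
    (N%:R^-1 * (\sum_(j in Pp) (t i j)%:R * (x j)%:R) +
     N%:R^-1 * (\sum_(j in ~: Pp) (t i j)%:R * (1 - (x j)%:R))).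

Definition transition (lambda mu : R) Pp t x y : R :=
  \prod_(i < N) bernoulli_pmf (spike_prob lambda mu Pp t x i) (y i).

Section process.
Context {d : measure_display} {Omega : measurableType d}.
Context {P : probability Omega R}.
Variable theta : 'I_N -> 'I_N -> {RV P >-> bool}.
Variable X : int -> 'I_N -> {RV P >-> bool}.

Definition theta_event t : set Omega :=
  [set w | forall i j, theta i j w = t i j].

(* X_s = x 0, ..., X_(s + n - 1) = x (n - 1) *)
Definition path_event (s : int) (n : nat) (x : nat -> {ffun 'I_N -> bool}) :
    set Omega :=
  [set w | forall k, (k < n)%N -> forall i, X (s + k%:Z) i w = x k i].

(* The conditional statements given theta are multiplied out by P(theta = t),
   so that nothing is asserted about null values of theta; likewise for the
   Markov property.  The invariant law of the chain is not named: it is forced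
   by the combination of stationarity and the Markov property. *)
Record is_model (lambda mu p : R) Pp : Prop := {
  theta_iid_bernoulli : forall t,
    P (theta_event t) = (\prod_(i < N) \prod_(j < N) bernoulli_pmf p (t i j))%:E;
  X_stationary : forall t s n (x : nat -> {ffun 'I_N -> bool}),
    P (theta_event t `&` path_event s n x) =
    P (theta_event t `&` path_event 0 n x);
  X_markov : forall t s n (x : nat -> {ffun 'I_N -> bool}),
    P (theta_event t `&` path_event s n.+2 x) =
    (P (theta_event t `&` path_event s n.+1 x) *
     (transition lambda mu Pp t (x n) (x n.+1))%:E)%E }.

End process.
End model.

Section estimators.
Context {R : realType} {N : nat}.

Section sample.
(* Y t is the observation X_t as a vector; only Y 1, ..., Y T.+1 are used. *)
Variables (Y : nat -> 'cV[R]_N) (T : nat).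

Definition mhat : 'cV[R]_N := T%:R^-1 *: \sum_(1 <= t < T.+1) Y t.

Definition Sigma1hat : 'M[R]_N :=
  T%:R^-1 *: \sum_(1 <= t < T.+1) (Y t.+1 - mhat) *m (Y t - mhat)^T.

Definition sigma_ag : 'cV[R]_N := Sigma1hat^T *m const_mx 1.

End sample.

Implicit Types (v : 'cV[R]_N) (S : {set 'I_N}) (C : {set 'I_N} * {set 'I_N}).

Definition cluster_mean v S : R := #|S|%:R^-1 * \sum_(i in S) v i 0.

Definition cluster_cost v S : R :=
  \sum_(i in S) (v i 0 - cluster_mean v S) ^+ 2.

(* C = (plus cluster, minus cluster).  Neither minimizers nor, when the two
   cluster means agree, labels need be unique. *)
Definition is_2means v C : Prop :=
  [/\ C.2 = ~: C.1, C.1 != finset.set0 /\ C.2 != finset.set0,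
      forall S, S != finset.set0 -> ~: S != finset.set0 ->
        cluster_cost v C.1 + cluster_cost v C.2 <=
        cluster_cost v S + cluster_cost v (~: S)
    & cluster_mean v C.2 <= cluster_mean v C.1].

Definition mean_threshold v : {set 'I_N} * {set 'I_N} :=
  let S := [set i | N%:R^-1 * (\sum_(j < N) v j 0) <= v i 0]%SET in (S, ~: S).

End estimators.

Definition sample_vector {R : realType} {N : nat} {d : measure_display}
    {Omega : measurableType d} {P : probability Omega R}
    (X : int -> 'I_N -> {RV P >-> bool}) (w : Omega) (t : nat) : 'cV[R]_N :=
  \col_i (X t%:Z i w)%:R.

(* Main.v *)
(** Stationarity plays no role: given [theta] and [X_t], the coordinates of
    [X_(t+1)] are independent with means [F_i(X_t) = a_i + L (A X_t)_i], where
    [L = 1 - lambda] and [A_ij = theta_ij s_j / N] with [s_j = +-1] the community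
    sign. Azuma's inequality for the martingale increments [y_i - F_i],
    [y_i y_j - F_i F_j] and [(y_j - F_j) x_i] makes all their time averages at
    most [e / N], off an event of probability [O(1/T)]; this is where
    [T >= K1 N^2 log^2 (T N)] enters. The empirical mean [m] and covariance [S]
    then satisfy, up to small errors, [m = a + L A m], [S_ii = m_i (1 - m_i)] and
    [S_ij = L^2 (A S A^T)_ij] for [i <> j], so the off-diagonal entries of [S] are
    [O(1/N)], while [sigma_ag] is close to [L q] with [q = c^T S], [c = A^T 1].
    With probability [1 - O(1/N)] all half row and column sums of [theta] are
    close to their means. Then [c^T A] is close to a multiple [rho] of [c], hence
    [q_i] is close to [c_i S_ii + L^2 rho (A q)_i], a sup-norm contraction whose
    homogeneous version is solved by an affine function of [s]. So [sigma_ag] is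
    uniformly close to a function with one value on each community, and these two
    values are separated by a constant gap, which both clusterings detect. *)

Require Import Defs.
From mathcomp Require Import ring lra.
Set Implicit Arguments.
Unset Strict Implicit.
Unset Printing Implicit Defensive.
Import Order.TTheory GRing.Theory Num.Theory.
Local Open Scope classical_set_scope.
Local Open Scope ring_scope.

(** * Concentration *)

(** From [1 - u <= expR (- u)], the product [(1 - u) * expR u] is at most 1, whereas
    [(1 - u) * (1 + u + 2 * u ^+ 2)] exceeds 1 by [u ^+ 2 * (1 - 2 * u)]. *)
Lemma expR_le_quad (R : realType) (u : R) : `|u| <= 1 / 2 -> expR u <= 1 + u + 2 * u ^+ 2.
Proof.
rewrite ler_norml => /andP[u1 u2].
have h : (1 - u) * expR u <= 1.
  by rewrite -[leRHS](expRxMexpNx_1 u) mulrC ler_wpM2l ?expR_ge0 // expR_ge1Dx.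
rewrite -(@ler_pM2l _ (1 - u)); last lra.
apply: (le_trans h).
rewrite -subr_ge0.
have -> : (1 - u) * (1 + u + 2 * u ^+ 2) - 1 = u ^+ 2 * (1 - 2 * u) by ring.
by rewrite mulr_ge0 ?sqr_ge0 //; lra.
Qed.

(** In the quadratic bound the linear term averages to zero and the square is at most [s ^+ 2]. This
    is Hoeffding's lemma for small [s], with a non-optimal constant. *)
Lemma mgf_centered_le (R : realType) (S : finType) (q h : S -> R) (s : R) :
  (forall y, 0 <= q y) -> \sum_y q y = 1 -> \sum_y q y * h y = 0 ->
  (forall y, `|h y| <= 1) -> `|s| <= 1 / 2 ->
  \sum_y q y * expR (s * h y) <= expR (2 * s ^+ 2).
Proof.
move=> q0 q1 qh h1 s1.
apply: (@le_trans _ _ (\sum_y q y * (1 + s * h y + 2 * s ^+ 2))).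
  apply: ler_sum => y _; rewrite ler_wpM2l //.
  have sh : `|s * h y| <= 1 / 2.
    by rewrite normrM -[leRHS]mulr1 ler_pM.
  apply: (le_trans (expR_le_quad sh)).
  rewrite lerD2l ler_wpM2l // exprMn ler_piMr ?sqr_ge0 //.
  by rewrite -real_normK ?num_real // expr_le1.
have -> : \sum_y q y * (1 + s * h y + 2 * s ^+ 2) =
    \sum_y q y * (1 + 2 * s ^+ 2) + s * \sum_y q y * h y.
  by rewrite mulr_sumr -big_split /=; apply: eq_bigr => y _; ring.
rewrite qh mulr0 addr0 -mulr_suml q1 mul1r.
exact: expR_ge1Dx.
Qed.

(** Markov's inequality for [expR (s * Z)] and [expR (- s * Z)]. The factor [M] stands for the total
    mass, so the bound applies to weights that do not sum to 1. *)
Lemma chernoff_two_sided (R : realType) (E : finType) (q Z : E -> R) (M n a : R) :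
  (forall e, 0 <= q e) -> 0 < n -> 0 <= a <= 2 * n ->
  (forall s, `|s| <= 1 / 2 ->
     \sum_e q e * expR (s * Z e) <= M * expR (2 * s ^+ 2 * n)) ->
  \sum_(e | a <= `|Z e|) q e <= 2 * M * expR (- (a ^+ 2 / (8 * n))).
Proof.
move=> q0 n0 /andP[a0 an] mgf.
have n_neq0 : n != 0 by rewrite gt_eqF.
(* The minimizer of [- (s * a) + 2 * s ^+ 2 * n], with minimum [- (a ^+ 2 / (8 * n))]; [a <= 2 * n]
   keeps [s] below [1 / 2]. *)
pose s := a / (4 * n).
have s0 : 0 <= s by rewrite divr_ge0 // mulr_ge0 // ltW.
have s1 : `|s| <= 1 / 2.
  rewrite ger0_norm // /s ler_pdivrMr ?mulr_gt0 //; lra.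
have key : expR (- (a ^+ 2 / (8 * n))) = expR (- (s * a)) * expR (2 * s ^+ 2 * n).
  rewrite -expRD; congr expR; rewrite /s; field; lra.
have sN1 : `|- s| <= 1 / 2 by rewrite normrN.
have m1 := mgf s s1; have m2 := mgf (- s) sN1.
have ptw e : a <= `|Z e| ->
    q e <= expR (- (s * a)) * (q e * expR (s * Z e) + q e * expR (- s * Z e)).
  move=> aZ; rewrite -mulrDr mulrCA -[leLHS]mulr1 ler_wpM2l //.
  have [Z0|Z0] := ger0P (Z e).
    rewrite ger0_norm // in aZ.
    rewrite mulrDr -!expRD; apply: le_trans (_ : expR (- (s * a) + s * Z e) <= _).
      by rewrite -[leLHS]expR0 ler_expR addrC subr_ge0 ler_wpM2l.
    by rewrite lerDl expR_ge0.
  rewrite ltr0_norm // in aZ.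
  rewrite mulrDr -!expRD; apply: le_trans (_ : expR (- (s * a) + - s * Z e) <= _).
    by rewrite -[leLHS]expR0 ler_expR addrC subr_ge0 mulNr -mulrN ler_wpM2l.
  by rewrite lerDr expR_ge0.
apply: (@le_trans _ _ (\sum_e expR (- (s * a)) *
    (q e * expR (s * Z e) + q e * expR (- s * Z e)))).
  rewrite [leRHS](bigID (fun e => a <= `|Z e|)) /= -[leLHS]addr0 lerD //.
    by apply: ler_sum => e; exact: ptw.
  by apply: sumr_ge0 => e _; rewrite mulr_ge0 ?addr_ge0 ?mulr_ge0 ?expR_ge0.
rewrite -mulr_sumr big_split /= key sqrrN in m2 *.
apply: (@le_trans _ _ (expR (- (s * a)) *
   (M * expR (2 * s ^+ 2 * n) + M * expR (2 * s ^+ 2 * n)))).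
  by rewrite ler_wpM2l ?expR_ge0 // lerD.
by rewrite le_eqVlt; apply/orP; left; apply/eqP; ring.
Qed.

Lemma big_ffun_recr (R : realType) (S : finType) (n : nat)
    (F : {ffun 'I_n.+2 -> S} -> R) :
  \sum_f F f = \sum_(g : {ffun 'I_n.+1 -> S}) \sum_(y : S)
     F [ffun i => if unlift ord_max i is Some j then g j else y].
Proof.
rewrite pair_bigA /=.
rewrite (reindex (fun gy : {ffun 'I_n.+1 -> S} * S =>
  [ffun i : 'I_n.+2 => if unlift ord_max i is Some j then gy.1 j else gy.2])) //=.
apply: onW_bij.
exists (fun f : {ffun 'I_n.+2 -> S} => ([ffun j => f (lift ord_max j)], f ord_max))
  => [[g y] | f] /=.
  congr pair; last by rewrite ffunE unlift_none.
  by apply/ffunP => j; rewrite !ffunE liftK.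
by apply/ffunP => i; rewrite ffunE; case: unliftP => [j ->|->] //; rewrite ffunE.
Qed.

(** The last state occurs in a single factor [K], whose row sums are at most [c], so it can be
    summed out first. Used for exponentially tilted kernels and, with [c = 1], to marginalize a
    trajectory. *)
Lemma path_sum_le (R : realType) (S : finType) (n : nat) (q0 : S -> R)
    (K : S -> S -> R) (c : R) :
  (forall x, 0 <= q0 x) -> (forall x y, 0 <= K x y) -> 0 <= c ->
  (forall x, \sum_y K x y <= c) ->
  \sum_(f : {ffun 'I_n.+1 -> S})
     q0 (f ord0) * \prod_(k < n) K (f (inord k)) (f (inord k.+1))
  <= (\sum_x q0 x) * c ^+ n.
Proof.
move=> q00 K0 c0 Kc; elim: n => [|n IHn].
  rewrite expr0 mulr1.
  rewrite (reindex (fun x : S => [ffun _ : 'I_1 => x])) /=.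
    by apply: ler_sum => x _; rewrite big_ord0 mulr1 ffunE.
  apply: onW_bij; exists (fun f : {ffun 'I_1 -> S} => f ord0) => [x|f].
    by rewrite ffunE.
  by apply/ffunP => i; rewrite ffunE (ord1 i).
rewrite big_ffun_recr exprSr mulrA.
apply: le_trans (ler_wpM2r c0 IHn).
rewrite mulr_suml; apply: ler_sum => g _.
pose e y : {ffun 'I_n.+2 -> S} :=
  [ffun i => if unlift ord_max i is Some j then g j else y].
have e_lt y k : (k < n.+1)%N -> e y (inord k) = g (inord k).
  move=> kn; rewrite ffunE.
  have -> : inord k = lift ord_max (inord k : 'I_n.+1) :> 'I_n.+2.
    apply: val_inj; rewrite /= inordK; last exact: ltnW. rewrite inordK //.
    by rewrite /bump leqNgt kn.
  by rewrite liftK.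
have e_max y : e y (inord n.+1) = y.
  rewrite ffunE; have -> : inord n.+1 = ord_max :> 'I_n.+2 by apply: val_inj; rewrite /= inordK.
  by rewrite unlift_none.
have -> : \sum_y (q0 (e y ord0) *
     \prod_(k < n.+1) K (e y (inord k)) (e y (inord k.+1))) =
   (q0 (g ord0) * \prod_(k < n) K (g (inord k)) (g (inord k.+1))) *
     \sum_y K (g (inord n)) y.
  rewrite mulr_sumr; apply: eq_bigr => y _.
  rewrite big_ord_recr /= e_max e_lt // !mulrA; congr (_ * _ * _).
    have i0 m : ord0 = inord 0 :> 'I_m.+1 by apply: val_inj; rewrite /= inordK.
    by rewrite (i0 n) (i0 n.+1) e_lt.
  by apply: eq_bigr => k _; rewrite !e_lt // ltnS // ltnW.
rewrite ler_wpM2l // mulr_ge0 ?prodr_ge0 //.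
Qed.

(* Summation over the last state turns the exponential of the martingale into a supermartingale. *)
Lemma markov_path_tail (R : realType) (S : finType) (n : nat) (q0 : S -> R)
    (Q h : S -> S -> R) (a : R) :
  (forall x, 0 <= q0 x) -> (forall x y, 0 <= Q x y) ->
  (forall x, \sum_y Q x y = 1) -> (forall x, \sum_y Q x y * h x y = 0) ->
  (forall x y, `|h x y| <= 1) -> (0 < n)%N -> 0 <= a <= 2 * n%:R ->
  \sum_(f : {ffun 'I_n.+1 -> S} |
        a <= `|\sum_(k < n) h (f (inord k)) (f (inord k.+1))|)
     q0 (f ord0) * \prod_(k < n) Q (f (inord k)) (f (inord k.+1))
  <= 2 * (\sum_x q0 x) * expR (- (a ^+ 2 / (8 * n%:R))).
Proof.
move=> q00 Q0 Q1 Qh h1 n0 an.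
apply: chernoff_two_sided => //; first by move=> f; rewrite mulr_ge0 ?prodr_ge0.
  by rewrite ltr0n.
move=> s s1.
have := @path_sum_le R S n q0 (fun x y => Q x y * expR (s * h x y)) (expR (2 * s ^+ 2)) q00.
rewrite -expRM_natr => H; apply: le_trans (H _ _ _); rewrite ?expR_ge0 //.
- rewrite le_eqVlt; apply/orP; left; apply/eqP.
  apply: eq_bigr => f _; rewrite -mulrA; congr (_ * _).
  by rewrite mulr_sumr expR_sum -big_split.
- by move=> x y; rewrite mulr_ge0 ?expR_ge0.
- by move=> x; exact: mgf_centered_le.
Qed.

(** * Clustering of a separated vector *)

Definition side (R : realType) (N : nat) (Pp : {set 'I_N}) (i : 'I_N) : R :=
  if i \in Pp then 1 else -1.

Lemma norm_side (R : realType) (N : nat) (Pp : {set 'I_N}) (i : 'I_N) :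
  `|side R Pp i| = 1.
Proof. by rewrite /side; case: ifP; rewrite ?normrN normr1. Qed.

Lemma sideC (R : realType) (N : nat) (Pp : {set 'I_N}) (i : 'I_N) :
  side R (~: Pp) i = - side R Pp i.
Proof. by rewrite /side inE; case: (i \in Pp); rewrite //= opprK. Qed.

Lemma sum_side (R : realType) (N : nat) (Pp : {set 'I_N}) :
  \sum_i side R Pp i = #|Pp|%:R - #|~: Pp|%:R.
Proof.
rewrite (bigID (mem Pp)) /= (eq_bigr (fun=> 1)); last by move=> i iP; rewrite /side iP.
rewrite sumr_const [X in _ + X](eq_bigr (fun=> -1)); last first.
  by move=> i iP; rewrite /side (negbTE iP).
rewrite sumr_const mulNrn; congr (_ - _%:R).
by apply: eq_card => i; rewrite !inE.
Qed.

Lemma card_setC_natr (R : realType) (N : nat) (Pp : {set 'I_N}) :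
  #|Pp|%:R + #|~: Pp|%:R = N%:R :> R.
Proof. by rewrite -natrD cardsC card_ord. Qed.

(** Up to [eta], the overall mean is [b + g * (#|Pp| - #|~: Pp|) / N], which is at least
    [2 * kappa * g] away from both levels [b + g] and [b - g]; this exceeds the two errors [eta]. *)
Lemma mean_threshold_separated (R : realType) (N : nat) (v : 'cV[R]_N)
    (Pp : {set 'I_N}) (b g eta kappa : R) :
  (0 < N)%N -> (forall i, `|v i 0 - b - g * side R Pp i| <= eta) ->
  kappa * N%:R <= #|Pp|%:R -> kappa * N%:R <= #|~: Pp|%:R -> 0 < g ->
  eta < kappa * g ->
  mean_threshold v = (Pp, ~: Pp).
Proof.
move=> N0 hv kP kM g0 hk.
have N0' : 0 < N%:R :> R by rewrite ltr0n.
suff E : [set i | N%:R^-1 * (\sum_(j < N) v j 0) <= v i 0]%SET = Pp.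
  by rewrite /mean_threshold E.
set M := _ * _.
have hM : `|N%:R * M - N%:R * b - g * (#|Pp|%:R - #|~: Pp|%:R)| <= N%:R * eta.
  rewrite -sum_side /M mulVKf ?gt_eqF //.
  have -> : \sum_j v j 0 - N%:R * b - g * \sum_i side R Pp i =
     \sum_j (v j 0 - b - g * side R Pp j).
    by rewrite !sumrB sumr_const card_ord mulr_natl mulr_sumr.
  apply: (le_trans (ler_norm_sum _ _ _)).
  have -> : N%:R * eta = \sum_(i < N) eta by rewrite sumr_const card_ord mulr_natl.
  exact: ler_sum.
move: hM; rewrite ler_norml => /andP[M1 M2].
have cN := card_setC_natr R Pp.
have hk' := ltr_pM2l N0' eta (kappa * g); rewrite hk in hk'.
have h1 : g * (kappa * N%:R) <= g * #|Pp|%:R by rewrite ler_pM2l.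
have h2 : g * (kappa * N%:R) <= g * #|~: Pp|%:R by rewrite ler_pM2l.
have h3 : g * #|Pp|%:R + g * #|~: Pp|%:R = N%:R * g by rewrite -mulrDr cN mulrC.
apply/setP => i; rewrite inE -(ler_pM2l N0').
have := hv i; rewrite /side ler_norml => /andP.
case: ifP => iP [v1 v2].
  have a1 : N%:R * (- eta) <= N%:R * (v i 0 - b - g * 1) by rewrite ler_pM2l.
  lra.
have a1 : N%:R * (v i 0 - b - g * -1) <= N%:R * eta by rewrite ler_pM2l.
apply/negbTE; rewrite -ltNge; lra.
Qed.

Lemma cluster_mean_sum (R : realType) (N : nat) (v : 'cV[R]_N) (S : {set 'I_N}) :
  S != finset.set0 -> #|S|%:R * cluster_mean v S = \sum_(i in S) v i 0.
Proof. by move=> S0; rewrite /cluster_mean mulVKf // pnatr_eq0 cards_eq0. Qed.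

(** For nonempty [S] with mean [m], the excess of the right-hand side is
    [#|S|%:R * (m - c) ^+ 2]. *)
Lemma cluster_cost_le (R : realType) (N : nat) (v : 'cV[R]_N) (S : {set 'I_N}) (c : R) :
  cluster_cost v S <= \sum_(i in S) (v i 0 - c) ^+ 2.
Proof.
have [->|S0] := eqVneq S finset.set0; first by rewrite /cluster_cost !big_set0.
have hs := cluster_mean_sum v S0.
set m := cluster_mean v S in hs *.
rewrite -subr_ge0.
have -> : \sum_(i in S) (v i 0 - c) ^+ 2 - cluster_cost v S = #|S|%:R * (m - c) ^+ 2.
  rewrite /cluster_cost -sumrB -/m.
  rewrite (eq_bigr (fun i => 2 * (m - c) * v i 0 + (c ^+ 2 - m ^+ 2))); last first.
    by move=> i _; ring.
  rewrite big_split /= -mulr_sumr -hs sumr_const -mulr_natl; ring.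
by rewrite mulr_ge0 // sqr_ge0.
Qed.

Lemma sum_ge_card (R : realType) (N : nat) (S B : {set 'I_N}) (f : 'I_N -> R) (c : R) :
  (forall i, 0 <= f i) -> (forall i, i \in B -> c <= f i) ->
  #|S :&: B|%:R * c <= \sum_(i in S) f i.
Proof.
move=> f0 fB; rewrite (big_setID B) /= -[leLHS]addr0 lerD ?sumr_ge0 //.
rewrite mulr_natl -sumr_const; apply: ler_sum => i; rewrite inE => /andP[_]; exact: fB.
Qed.

(** The symmetry that carries results on the plus cluster over to the minus cluster. *)
Lemma is_2means_opp (R : realType) (N : nat) (v : 'cV[R]_N) (C : {set 'I_N} * {set 'I_N}) :
  is_2means v C -> is_2means (- v) (C.2, C.1).
Proof.
have mN S : cluster_mean (- v) S = - cluster_mean v S.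
  by rewrite /cluster_mean -mulrN -sumrN; congr (_ * _); apply: eq_bigr => i _; rewrite mxE.
have cN S : cluster_cost (- v) S = cluster_cost v S.
  by apply: eq_bigr => i _; rewrite mN mxE -opprD sqrrN.
case=> C2 [n1 n2] hmin hm; split => /=.
- by rewrite C2 finset.setCK.
- by [].
- by move=> S S0 SC0; rewrite !cN [leLHS]addrC; exact: hmin.
- by rewrite !mN lerN2.
Qed.

(* Both centres lie on their own side of the midpoint, since otherwise a whole
   community would be far from its centre; a misplaced point would then be
   strictly closer to the other centre. *)
Lemma two_means_plus_subset (R : realType) (N : nat) (v : 'cV[R]_N)
    (C : {set 'I_N} * {set 'I_N}) (Pp : {set 'I_N}) (b g eta kappa : R) :
  (0 < N)%N -> is_2means v C ->
  (forall i, `|v i 0 - b - g * side R Pp i| <= eta) ->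
  kappa * N%:R <= #|Pp|%:R -> kappa * N%:R <= #|~: Pp|%:R ->
  0 < kappa -> 0 < g -> 8 * eta <= kappa * g ->
  C.1 \subset Pp.
Proof.
move=> N0 [C2 [n1 n2] hmin hm] hv kP kM k0 g0 hk.
rewrite C2 in n2 hmin hm.
move: (C.1) n1 n2 hmin hm => {C2} {C} A A0 Ac0 hmin hm.
set m1 := cluster_mean v A in hm *; set m2 := cluster_mean v (~: A) in hm *.
have N0' : 0 < N%:R :> R by rewrite ltr0n.
have cN := card_setC_natr R Pp.
have k_half : kappa <= 1 / 2.
  by rewrite -(ler_pM2r N0'); lra.
have eta0 : 0 <= eta by apply: le_trans (hv (Ordinal N0)).
have eta16 : 16 * eta <= g.
  have : kappa * g <= 1 / 2 * g by rewrite ler_pM2r.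
  lra.
have hvP i : i \in Pp -> b + g - eta <= v i 0 <= b + g + eta.
  by move=> iP; have := hv i; rewrite /side iP ler_norml => /andP[? ?]; apply/andP; split; lra.
have hvM i : i \in ~: Pp -> b - g - eta <= v i 0 <= b - g + eta.
  rewrite inE => /negbTE iP.
  by have := hv i; rewrite /side iP ler_norml => /andP[? ?]; apply/andP; split; lra.
(* Optimality is compared with the true partition, whose points lie within [eta] of [b + g] or
   [b - g]. *)
have total : cluster_cost v A + cluster_cost v (~: A) <= N%:R * eta ^+ 2.
  have side_cost (S : {set 'I_N}) c :
      (forall i, i \in S -> `|v i 0 - c| <= eta) -> cluster_cost v S <= #|S|%:R * eta ^+ 2.
    move=> hS; apply: (le_trans (cluster_cost_le v S c)).
    rewrite mulr_natl -sumr_const; apply: ler_sum => i iS.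
    by rewrite -real_normK ?num_real // lerXn2r ?nnegrE // hS.
  have Pp0 : Pp != finset.set0.
    by apply: contraTneq kP => ->; rewrite cards0 -ltNge mulr_gt0.
  have Pc0 : ~: Pp != finset.set0.
    by apply: contraTneq kM => ->; rewrite cards0 -ltNge mulr_gt0.
  apply: (le_trans (hmin _ Pp0 Pc0)); rewrite -cN mulrDl lerD //.
    apply: (@side_cost _ (b + g)) => i /hvP /andP[? ?].
    by rewrite ler_norml; apply/andP; split; lra.
  apply: (@side_cost _ (b - g)) => i /hvM /andP[? ?].
  by rewrite ler_norml; apply/andP; split; lra.
have cost_ge0 S : 0 <= cluster_cost v S.
  by apply: sumr_ge0 => i _; rewrite sqr_ge0.
(* If [n] points at distance [g - eta] fit in the total cost, then [n] is at most
   [(16 / 15) ^+ 2 / 64 * kappa ^+ 2 * N], and [kappa <= 1 / 2] brings this below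
   [kappa * N / 100]. *)
have few n : 0 <= n -> n * (g - eta) ^+ 2 <= N%:R * eta ^+ 2 -> 100 * n <= kappa * N%:R.
  move=> n0 hn.
  have e1 : (15 / 16 * g) ^+ 2 <= (g - eta) ^+ 2 by rewrite lerXn2r ?nnegrE //; lra.
  have e2 : (8 * eta) ^+ 2 <= (kappa * g) ^+ 2.
    by rewrite lerXn2r ?nnegrE // mulr_ge0 // ltW.
  have e3 : n * (15 / 16 * g) ^+ 2 <= n * (g - eta) ^+ 2 by rewrite ler_wpM2l.
  have e4 : N%:R * (8 * eta) ^+ 2 <= N%:R * (kappa * g) ^+ 2 by rewrite ler_pM2l.
  have e5 : (kappa * N%:R) * kappa <= (kappa * N%:R) * (1 / 2).
    by rewrite ler_wpM2l // mulr_ge0 // ltW.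
  have e6 : g ^+ 2 * (N%:R * kappa ^+ 2) <= g ^+ 2 * (kappa * N%:R / 2).
    by rewrite ler_wpM2l ?sqr_ge0 //; lra.
  have e7 : 0 <= g ^+ 2 * (kappa * N%:R).
    by rewrite mulr_ge0 ?sqr_ge0 // mulr_ge0 // ltW.
  rewrite -(@ler_pM2l _ (g ^+ 2)) ?exprn_gt0 //; lra.
have far_low (S B : {set 'I_N}) c : (forall i, i \in B -> g - eta <= `|v i 0 - c|) ->
    #|S :&: B|%:R * (g - eta) ^+ 2 <= \sum_(i in S) (v i 0 - c) ^+ 2.
  move=> hB; apply: sum_ge_card => [i|i iB]; first exact: sqr_ge0.
  rewrite -[leRHS]real_normK ?num_real // lerXn2r ?nnegrE ?hB //; lra.
have farP c : c <= b -> forall i, i \in Pp -> g - eta <= `|v i 0 - c|.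
  by move=> cb i /hvP /andP[? ?]; rewrite ger0_norm; lra.
have farM c : b <= c -> forall i, i \in ~: Pp -> g - eta <= `|v i 0 - c|.
  by move=> cb i /hvM /andP[? ?]; rewrite ler0_norm; lra.
have cardsplit (B : {set 'I_N}) : #|A :&: B|%:R + #|~: A :&: B|%:R = #|B|%:R :> R.
  by rewrite -natrD finset.setIC [X in (_ + #|pred_of_set X|)%N]finset.setIC -finset.setDE cardsID.
have m1b : b < m1.
  rewrite ltNge; apply/negP => m1b.
  have m2b : m2 <= b by apply: le_trans m1b.
  have := far_low A _ _ (farP _ m1b); have := far_low (~: A) _ _ (farP _ m2b).
  rewrite -/(cluster_cost v A) -/(cluster_cost v (~: A)) => h1 h2.
  have := few #|Pp|%:R; rewrite ler0n => /(_ isT) h.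
  have h' : #|Pp|%:R * (g - eta) ^+ 2 <= N%:R * eta ^+ 2.
    by rewrite -cardsplit mulrDl; lra.
  have := h h'; have := mulr_gt0 k0 N0'; lra.
have m2b : m2 < b.
  rewrite ltNge; apply/negP => m2b.
  have := far_low A _ _ (farM _ (ltW m1b)); have := far_low (~: A) _ _ (farM _ m2b).
  rewrite -/(cluster_cost v A) -/(cluster_cost v (~: A)) => h1 h2.
  have := few #|~: Pp|%:R; rewrite ler0n => /(_ isT) h.
  have h' : #|~: Pp|%:R * (g - eta) ^+ 2 <= N%:R * eta ^+ 2.
    by rewrite -cardsplit mulrDl; lra.
  have := h h'; have := mulr_gt0 k0 N0'; lra.
have fewA : 100 * #|A :&: ~: Pp|%:R <= kappa * N%:R.
  apply: few; rewrite ?ler0n //.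
  have := far_low A _ _ (farM _ (ltW m1b)); have := cost_ge0 (~: A).
  rewrite -/(cluster_cost v A); lra.
have fewC : 100 * #|~: A :&: Pp|%:R <= kappa * N%:R.
  apply: few; rewrite ?ler0n //.
  have := far_low (~: A) _ _ (farP _ (ltW m2b)); have := cost_ge0 A.
  rewrite -/(cluster_cost v (~: A)); lra.
have manyA : 99 * (kappa * N%:R) <= 100 * #|A :&: Pp|%:R.
  have := cardsplit Pp; lra.
have cardA : #|A|%:R = #|A :&: Pp|%:R + #|A :&: ~: Pp|%:R :> R.
  by rewrite -natrD -finset.setDE cardsID.
have kN0 : 0 < kappa * N%:R by rewrite mulr_gt0.
(* In [A] the plus points outnumber the minus points by a factor of at least 99. *)
have m1g : b + g / 2 <= m1.
  have hs := cluster_mean_sum v A0; rewrite -/m1 in hs.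
  have h1 : #|A :&: Pp|%:R * (b + g - eta) + #|A :&: ~: Pp|%:R * (b - g - eta)
      <= \sum_(i in A) v i 0.
    rewrite [leRHS](big_setID Pp) /= -finset.setDE !mulr_natl -!sumr_const.
    rewrite lerD //; apply: ler_sum => i; rewrite !inE => /andP[i1 i2].
      by have /andP[] := hvP _ i2.
    by have := hvM i; rewrite inE i1 => /(_ isT) /andP[].
  rewrite leNgt; apply/negP => m1g.
  have cA0 : 0 < #|A|%:R :> R by rewrite ltr0n card_gt0.
  have h2 : #|A|%:R * m1 < #|A|%:R * (b + g / 2) by rewrite ltr_pM2l.
  rewrite hs cardA in h2.
  have nP := ler0n R #|A :&: Pp|; have nM := ler0n R #|A :&: ~: Pp|.
  have h3 : #|A :&: Pp|%:R * (16 * eta) <= #|A :&: Pp|%:R * g by rewrite ler_wpM2l.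
  have h4 : #|A :&: ~: Pp|%:R * (16 * eta) <= #|A :&: ~: Pp|%:R * g by rewrite ler_wpM2l.
  have h5 : g * (99 * #|A :&: ~: Pp|%:R) <= g * #|A :&: Pp|%:R by rewrite ler_pM2l //; lra.
  have h6 : 0 < g * #|A :&: Pp|%:R by rewrite mulr_gt0 //; lra.
  lra.
have m2g : b - g - eta <= m2.
  have hs := cluster_mean_sum v Ac0; rewrite -/m2 in hs.
  have cA0 : 0 < #|~: A|%:R :> R by rewrite ltr0n card_gt0.
  rewrite -(ler_pM2l cA0) hs mulr_natl -sumr_const; apply: ler_sum => i _.
  have [/hvP/andP[? ?]|] := boolP (i \in Pp); first lra.
  by move=> iP; have := hvM i; rewrite inE iP => /(_ isT) /andP[].
apply/fintype.subsetP => i iA; apply/negPn/negP => iP.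
have /andP[vi1 vi2] : b - g - eta <= v i 0 <= b - g + eta by apply: hvM; rewrite inE.
(* Moving [i] across leaves both clusters nonempty. The old centres [m1] and [m2] are kept: they
   bound the new cost from above. *)
pose B := A :\ i.
have B0 : B != finset.set0.
  have : (0 < #|A :&: Pp|)%N by rewrite -(ltr0n R); lra.
  rewrite card_gt0 => /set0Pn[j]; rewrite inE => /andP[jA jP].
  apply/set0Pn; exists j; rewrite !inE jA andbT.
  by apply: contraNneq iP => <-.
have Bc : ~: B = i |: ~: A by rewrite /B finset.setDE finset.setCI finset.setCK finset.setUC.
have Bc0 : ~: B != finset.set0 by apply/set0Pn; exists i; rewrite Bc !inE eqxx.
have := hmin _ B0 Bc0.
have hB := cluster_cost_le v B m1; have hBc := cluster_cost_le v (~: B) m2.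
have eA : cluster_cost v A = (v i 0 - m1) ^+ 2 + \sum_(i in B) (v i 0 - m1) ^+ 2.
  by rewrite /cluster_cost (big_setD1 i).
have eB : \sum_(i in ~: B) (v i 0 - m2) ^+ 2 = (v i 0 - m2) ^+ 2 + cluster_cost v (~: A).
  by rewrite Bc big_setU1 //= !inE iA.
have lt : (v i 0 - m2) ^+ 2 < (v i 0 - m1) ^+ 2.
  rewrite -subr_gt0 -[X in 0 < X]/(_ - _).
  have -> : (v i 0 - m1) ^+ 2 - (v i 0 - m2) ^+ 2 = (m1 - m2) * (m1 + m2 - 2 * v i 0) by ring.
  rewrite mulr_gt0 //; lra.
lra.
Qed.

(** The inclusion applied to [v] and to [- v] puts each cluster inside its own community; as both
    pairs are complementary, equality follows. *)
Lemma two_means_separated (R : realType) (N : nat) (v : 'cV[R]_N)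
    (C : {set 'I_N} * {set 'I_N}) (Pp : {set 'I_N}) (b g eta kappa : R) :
  (0 < N)%N -> is_2means v C ->
  (forall i, `|v i 0 - b - g * side R Pp i| <= eta) ->
  kappa * N%:R <= #|Pp|%:R -> kappa * N%:R <= #|~: Pp|%:R ->
  0 < kappa -> 0 < g -> 8 * eta <= kappa * g ->
  C = (Pp, ~: Pp).
Proof.
move=> N0 hC hv kP kM k0 g0 hk.
have s1 := two_means_plus_subset N0 hC hv kP kM k0 g0 hk.
have s2 : C.2 \subset ~: Pp.
  apply: (@two_means_plus_subset R N (- v) (C.2, C.1) (~: Pp) (- b) g eta kappa) => //.
  - exact: is_2means_opp.
  - move=> i; rewrite mxE sideC -normrN; apply: le_trans (hv i).
    by rewrite le_eqVlt; apply/orP; left; apply/eqP; congr `|_|; ring.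
  - by rewrite finset.setCK.
case: hC => C2 _ _ _.
case: C C2 s1 s2 => C1 C2 /= -> s1 s2.
rewrite finset.setCS in s2.
by congr (_, ~: _); apply/eqP; rewrite finset.eqEsubset s1 s2.
Qed.

(** * Approximate fixed-point equations for the covariance *)

(** The hypothesis is applied at an index of maximal [|x i|], with [M] equal to that maximum. *)
Lemma sup_contraction (R : realType) (I : finType) (x : I -> R) (L beta : R) :
  L < 1 ->
  (forall M, (forall j, `|x j| <= M) -> forall i, `|x i| <= beta + L * M) ->
  forall i, `|x i| <= beta / (1 - L).
Proof.
move=> L1 hx i.
have L1' : 0 < 1 - L by rewrite subr_gt0.
pose i0 := [arg max_(j > i) `|x j|]%O.
have hmax j : `|x j| <= `|x i0|.
  by rewrite /i0; case: arg_maxP => // k _; apply.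
apply: (le_trans (hmax i)).
have := hx _ hmax i0.
rewrite ler_pdivlMr //; lra.
Qed.

Lemma ler_norm_sum_mul (R : realType) (I : finType) (u w : I -> R) (U W : R) :
  0 <= U -> (forall j, `|u j| <= U) -> \sum_j `|w j| <= W ->
  `|\sum_j u j * w j| <= U * W.
Proof.
move=> U0 hu hw; apply: (le_trans (ler_norm_sum _ _ _)).
apply: (@le_trans _ _ (\sum_j U * `|w j|)).
  by apply: ler_sum => j _; rewrite normrM ler_wpM2r.
by rewrite -mulr_sumr ler_wpM2l.
Qed.

Lemma norm_mulmx_row_le (R : realType) (N : nat) (u : 'rV[R]_N) (B : 'M[R]_N)
    (U W : R) (i : 'I_N) :
  0 <= U -> (forall j, `|u 0 j| <= U) -> \sum_j `|B j i| <= W ->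
  `|(u *m B) 0 i| <= U * W.
Proof. by move=> U0 hu hw; rewrite mxE; exact: ler_norm_sum_mul. Qed.

Lemma bernoulli_variance_lipschitz (R : realType) (x y : R) :
  0 <= x <= 1 -> 0 <= y <= 1 -> `|x * (1 - x) - y * (1 - y)| <= `|x - y|.
Proof.
move=> /andP[x0 x1] /andP[y0 y1].
have -> : x * (1 - x) - y * (1 - y) = (x - y) * (1 - x - y) by ring.
rewrite normrM ler_piMr // ler_norml; apply/andP; split; lra.
Qed.

Section profile.
Variables (R : realType) (N : nat).
Variables (A Sg : 'M[R]_N) (m s : 'I_N -> R) (L p rho ms delta : R).
Hypothesis N0 : (0 < N)%N.
Hypothesis L0 : 0 < L.
Hypothesis L1 : L < 1.
Hypothesis p01 : 0 <= p <= 1.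
Hypothesis rho1 : `|rho| <= 1.
Hypothesis delta01 : 0 < delta <= 1.
Hypothesis N_large : 3 <= (1 - L) * delta * N%:R.
Hypothesis s1 : forall i, `|s i| = 1.
Hypothesis A_le : forall i j, `|A i j| <= N%:R^-1.
Hypothesis A_row : forall i, `|\sum_j A i j - rho| <= 2 * delta.
Hypothesis A_row_s : forall i, `|\sum_j A i j * s j - p| <= 2 * delta.
Hypothesis A_col : forall j, `|\sum_i A i j - p * s j| <= 2 * delta.
Hypothesis A_col_s : forall j, `|\sum_i s i * A i j - rho * s j| <= 2 * delta.
Hypothesis ms01 : 0 <= ms <= 1.
Hypothesis m01 : forall i, 0 <= m i <= 1.
Hypothesis m_eq : forall i,
  `|m i - (ms * (1 - L * rho) + L * \sum_j A i j * m j)| <= 2 * delta.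
Hypothesis Sg_diag : forall i, Sg i i = m i * (1 - m i).
Hypothesis Sg_off : forall i j, i != j ->
  `|Sg i j - L ^+ 2 * (A *m Sg *m A^T) i j| <= delta / N%:R.

Let lam := 1 - L.
Let lam0 : 0 < lam. Proof. by rewrite subr_gt0. Qed.
Let lam1 : lam < 1. Proof. by rewrite gtrBl. Qed.
Let N0' : 0 < N%:R :> R. Proof. by rewrite ltr0n. Qed.

Let sum_le1 (w : 'I_N -> R) : (forall j, `|w j| <= N%:R^-1) -> \sum_j `|w j| <= 1.
Proof.
move=> hw; apply: (@le_trans _ _ (\sum_(j < N) N%:R^-1)); first exact: ler_sum.
by rewrite sumr_const card_ord -[leLHS]mulr_natl divff // gt_eqF.
Qed.

Let A_row1 i : \sum_j `|A i j| <= 1. Proof. exact: sum_le1. Qed.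
Let A_col1 j : \sum_i `|A i j| <= 1. Proof. exact: sum_le1. Qed.

(** The constant [ms] solves the mean equation with all row sums of [A] equal to [rho]. Hence
    [m - ms] obeys a contraction of factor [L], with error [2 * delta] from [m_eq] and [2 * delta]
    from the row sums. *)
Lemma profile_mean i : `|m i - ms| <= 4 * delta / lam.
Proof.
have /andP[d0 d1] := delta01; have /andP[ms0 ms1] := ms01.
apply: (@sup_contraction _ _ (fun i => m i - ms) L) => // M hM {}i.
have M0 : 0 <= M by apply: le_trans (hM i).
have -> : m i - ms = (m i - (ms * (1 - L * rho) + L * \sum_j A i j * m j))
   + L * \sum_j (m j - ms) * A i j + L * (ms * (\sum_j A i j - rho)).
  under [X in _ + L * X + _]eq_bigr do rewrite mulrBl mulrC.
  rewrite sumrB -mulr_sumr; ring.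
apply: (le_trans (ler_normD _ _)); apply: (le_trans (lerD (ler_normD _ _) (lexx _))).
have h1 : `|L * \sum_j (m j - ms) * A i j| <= L * M.
  rewrite normrM gtr0_norm // ler_wpM2l ?(ltW L0) //; rewrite -[leRHS]mulr1.
  exact: ler_norm_sum_mul.
have h2 : `|L * (ms * (\sum_j A i j - rho))| <= 2 * delta.
  rewrite !normrM (gtr0_norm L0) (ger0_norm ms0) mulrA.
  apply: le_trans (A_row i); rewrite ler_piMl //; rewrite -[leRHS]mulr1 ler_pM ?(ltW L0) ?(ltW L1) //.
have := m_eq i; lra.
Qed.

(** The diagonal is of order 1 and would spoil a bound of order [1 / N]; zeroing it lets
    [sup_contraction] act on the off-diagonal entries alone. *)
Let offdiag (ij : 'I_N * 'I_N) := if ij.1 == ij.2 then 0 else Sg ij.1 ij.2.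

Let Sg_le1 i : `|Sg i i| <= 1.
Proof.
rewrite Sg_diag; have /andP[m0 m1] := m01 i.
rewrite ger0_norm ?mulr_ge0 ?subr_ge0 //; rewrite -[leRHS]mulr1 ler_pM ?subr_ge0 //; lra.
Qed.

Let Sg_split M : (forall ij, `|offdiag ij| <= M) ->
  forall k l, `|Sg k l| <= M + (k == l)%:R.
Proof.
move=> hM k l; have M0 : 0 <= M by apply: le_trans (hM (k, l)).
have [->|kl] := eqVneq k l; first by apply: (le_trans (Sg_le1 l)); rewrite lerDr.
by have := hM (k, l); rewrite /offdiag /= (negbTE kl) addr0.
Qed.

(** Rows of [A] have absolute sum at most 1, so off-diagonal entries contribute at most [M]. The
    diagonal ones contribute the sum of [|A i k| * |A j k|], at most [1 / N]. *)
Let ASA_le M : (forall ij, `|offdiag ij| <= M) ->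
  forall i j, `|(A *m Sg *m A^T) i j| <= M + N%:R^-1.
Proof.
move=> hM i j; have M0 : 0 <= M by apply: le_trans (hM (i, i)).
rewrite mxE; under eq_bigr do rewrite !mxE.
apply: (le_trans (ler_norm_sum _ _ _)).
apply: (@le_trans _ _ (\sum_l (M * `|A j l| + N%:R^-1 * `|A j l|))); last first.
  rewrite big_split -!mulr_sumr /= lerD // ler_piMr // ?invr_ge0 //.
apply: ler_sum => l _; rewrite normrM -mulrDl ler_wpM2r //.
apply: (le_trans (ler_norm_sum _ _ _)).
apply: (@le_trans _ _ (\sum_k (M * `|A i k| + (if k == l then N%:R^-1 else 0)))).
  apply: ler_sum => k _; rewrite normrM mulrC.
  apply: (le_trans (ler_wpM2r (normr_ge0 _) (Sg_split hM k l))).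
  by rewrite mulrDl lerD2l; case: (k == l); rewrite ?mul1r ?mul0r.
rewrite big_split -mulr_sumr -big_mkcond /= big_pred1_eq lerD // ler_piMr //.
Qed.

(** By [ASA_le], a bound [M] improves to [delta / N + L ^+ 2 * (M + 1 / N)], which is at most
    [2 / N + L * M]. *)
Let offdiag_le ij : `|offdiag ij| <= 2 / N%:R / lam.
Proof.
have /andP[d0 d1] := delta01.
apply: sup_contraction => // M hM {ij} [i j].
have M0 : 0 <= M by apply: le_trans (hM (i, j)).
have iN0 : 0 < N%:R^-1 :> R by rewrite invr_gt0.
rewrite /offdiag /=; case: ifPn => [_|ij].
  by rewrite normr0 addr_ge0 ?mulr_ge0 // ltW.
rewrite -[X in `|X|](subrK (L ^+ 2 * (A *m Sg *m A^T) i j)).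
apply: (le_trans (ler_normD _ _)).
have := Sg_off ij; have := ASA_le hM i j.
set w := (_ *m _) i j => hw ho.
have h2 : `|L ^+ 2 * w| <= L * M + N%:R^-1.
  rewrite normrM ger0_norm ?sqr_ge0 //.
  apply: (@le_trans _ _ (L * (M + N%:R^-1))).
    by rewrite ler_pM ?sqr_ge0 // expr2 ler_piMl // ltW.
  by rewrite mulrDr lerD2l ler_piMl // ltW.
have h3 : delta / N%:R <= N%:R^-1 by rewrite ler_piMl // ltW.
lra.
Qed.

Lemma profile_sandwich_le i j : `|(A *m Sg *m A^T) i j| <= delta.
Proof.
apply: (le_trans (ASA_le offdiag_le i j)).
have h : (2 / N%:R / lam + N%:R^-1) * (lam * N%:R) = 2 + lam.
  by field; rewrite !gt_eqF.
have lN : 0 < lam * N%:R by rewrite mulr_gt0.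
rewrite -(ler_pM2r lN) h; move: N_large; rewrite -/lam => ?.
have := lam1; lra.
Qed.

Lemma profile_col_le i : \sum_j `|Sg j i| <= 3 / lam.
Proof.
apply: (@le_trans _ _ (\sum_j (2 / N%:R / lam + (j == i)%:R))).
  by apply: ler_sum => j _; exact: Sg_split offdiag_le _ _.
rewrite big_split /= sumr_const card_ord -natr_sum.
rewrite [X in _ + X%:R](bigD1 i) //= eqxx big1 => [|j /negbTE -> //].
rewrite addn0.
have -> : 2 / N%:R / lam *+ N = 2 / lam.
  by rewrite -mulr_natl; field; rewrite !gt_eqF.
have -> : 3 / lam = 2 / lam + 1 / lam by field; rewrite gt_eqF.
by rewrite lerD2l ler_pdivlMr // mul1r (ltW lam1).
Qed.

Let c : 'rV[R]_N := const_mx 1 *m A.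
Let q : 'rV[R]_N := c *m Sg.

Let cE j : c 0 j = \sum_i A i j.
Proof. by rewrite mxE; apply: eq_bigr => i _; rewrite mxE mul1r. Qed.

Let c1 j : `|c 0 j| <= 1.
Proof. by rewrite cE; apply: (le_trans (ler_norm_sum _ _ _)). Qed.

Let cp j : `|c 0 j - p * s j| <= 2 * delta.
Proof. by rewrite cE. Qed.

(** Replacing [c] by [p * s], using that [s] is nearly a left eigenvector of [A] for [rho], and
    going back to [c] costs [2 * delta] each. *)
Lemma profile_cA j : `|(c *m A - rho *: c) 0 j| <= 6 * delta.
Proof.
have /andP[d0 d1] := delta01; have /andP[p0 p1] := p01.
have -> : (c *m A - rho *: c) 0 j = \sum_i (c 0 i - p * s i) * A i j
   + p * (\sum_i s i * A i j - rho * s j) - rho * (c 0 j - p * s j).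
  have E (u w : 'rV[R]_N) : (u - rho *: w) 0 j = u 0 j - rho * w 0 j by rewrite !mxE.
  rewrite E [(c *m A) 0 j]mxE; under [in RHS]eq_bigr do rewrite mulrBl.
  rewrite sumrB mulrBr mulr_sumr; under [X in _ - X + _]eq_bigr do rewrite -mulrA.
  ring.
have h1 : `|\sum_i (c 0 i - p * s i) * A i j| <= 2 * delta.
  rewrite -[leRHS]mulr1; apply: ler_norm_sum_mul => //; lra.
have h2 : `|p * (\sum_i s i * A i j - rho * s j)| <= 2 * delta.
  by rewrite normrM (ger0_norm p0); apply: le_trans (A_col_s j); rewrite ler_piMl.
have h3 : `|rho * (c 0 j - p * s j)| <= 2 * delta.
  by rewrite normrM; apply: le_trans (cp j); rewrite ler_piMl.
apply: (le_trans (ler_normB _ _)); apply: (le_trans (lerD (ler_normD _ _) (lexx _))).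
lra.
Qed.

(** The term [j = i] of [q 0 i] is kept; in the others [Sg] is replaced by [L ^+ 2 * W]. The missing
    diagonal term of [W] is negligible, and [c *m W] is close to [rho *: (q *m A^T)] since [c *m A]
    is close to [rho *: c]. The errors are [delta], [delta] and [18 * delta / lam], with
    [18 = 6 * 3] from [profile_cA] and [profile_col_le]. *)
Lemma profile_fixpoint i :
  `|q 0 i - c 0 i * Sg i i - L ^+ 2 * rho * (q *m A^T) 0 i| <= 20 * delta / lam.
Proof.
have /andP[d0 d1] := delta01.
pose W := A *m Sg *m A^T.
have ql : q 0 i = c 0 i * Sg i i + \sum_(j | j != i) c 0 j * Sg j i.
  by rewrite mxE (bigD1 i).
have cW : (c *m W) 0 i = c 0 i * W i i + \sum_(j | j != i) c 0 j * W j i.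
  by rewrite mxE (bigD1 i).
have cW2 : c *m W = rho *: (q *m A^T) + (c *m A - rho *: c) *m Sg *m A^T.
  by rewrite /W /q !mulmxBl !mulmxA -!scalemxAl [RHS]addrC subrK.
have h0 : L ^+ 2 <= 1 by rewrite expr_le1 // ltW.
have h1 : `|\sum_(j | j != i) c 0 j * (Sg j i - L ^+ 2 * W j i)| <= delta.
  apply: (le_trans (ler_norm_sum _ _ _)).
  apply: (@le_trans _ _ (\sum_(j < N) delta / N%:R)).
    rewrite big_mkcond; apply: ler_sum => j _; case: ifP => ji.
      by rewrite normrM -[leRHS]mul1r ler_pM // Sg_off.
    by rewrite divr_ge0 // ltW.
  rewrite sumr_const card_ord -[leLHS]mulr_natl mulrC divfK // gt_eqF //.
have h2 : `|L ^+ 2 * (c 0 i * W i i)| <= delta.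
  rewrite normrM (ger0_norm (sqr_ge0 _)) normrM; apply: le_trans (profile_sandwich_le i i).
  rewrite mulrA ler_piMl //; rewrite -[leRHS]mulr1 ler_pM ?sqr_ge0 //.
have h3 : `|L ^+ 2 * ((c *m A - rho *: c) *m Sg *m A^T) 0 i| <= 18 * delta / lam.
  rewrite normrM (ger0_norm (sqr_ge0 _)).
  apply: (@le_trans _ _ (1 * `|((c *m A - rho *: c) *m Sg *m A^T) 0 i|)).
    by rewrite ler_wpM2r.
  rewrite mul1r -[leRHS]mulr1.
  have dl : 0 <= 18 * delta / lam by rewrite divr_ge0 ?mulr_ge0 // ltW.
  apply: norm_mulmx_row_le => // [j|]; last by under eq_bigr do rewrite mxE.
  have -> : 18 * delta / lam = 6 * delta * (3 / lam) by field; rewrite gt_eqF.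
  apply: norm_mulmx_row_le; [lra|exact: profile_cA|exact: profile_col_le].
have -> : q 0 i - c 0 i * Sg i i - L ^+ 2 * rho * (q *m A^T) 0 i =
    \sum_(j | j != i) c 0 j * (Sg j i - L ^+ 2 * W j i)
    - L ^+ 2 * (c 0 i * W i i) + L ^+ 2 * ((c *m A - rho *: c) *m Sg *m A^T) 0 i.
  have -> : ((c *m A - rho *: c) *m Sg *m A^T) 0 i =
      (c *m W) 0 i - rho * (q *m A^T) 0 i.
    have E (u w : 'rV[R]_N) : (rho *: u + w) 0 i = rho * u 0 i + w 0 i by rewrite !mxE.
    by rewrite cW2 E addrAC subrr add0r.
  rewrite cW ql; under [in RHS]eq_bigr do rewrite mulrBr mulrCA.
  rewrite sumrB -mulr_sumr; ring.
apply: (le_trans (ler_normD _ _)); apply: (le_trans (lerD (ler_normB _ _) (lexx _))).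
have : delta <= delta / lam by rewrite ler_pdivlMr // ler_piMr ?(ltW d0) ?(ltW lam1).
lra.
Qed.

(* The exact solution of the fixed-point equation for homogeneous [A] is affine in [s]. *)
Lemma covariance_profile : exists k, forall i,
  `|((const_mx 1 : 'rV[R]_N) *m A *m Sg) 0 i - k - p * (ms * (1 - ms)) * s i|
  <= 30 * delta / (1 - L) ^+ 2.
Proof.
have /andP[d0 d1] := delta01; have /andP[p0 p1] := p01; have /andP[ms0 ms1] := ms01.
pose tau := L ^+ 2 * rho; pose v := ms * (1 - ms).
have tauL : `|tau| <= L.
  rewrite normrM (ger0_norm (sqr_ge0 _)) -[leRHS]mulr1 ler_pM ?sqr_ge0 //.
  by rewrite expr2 ler_piMl // ltW.
have tau1 : `|tau| <= 1 by apply: le_trans tauL (ltW L1).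
have taur : lam <= 1 - tau * rho.
  rewrite lerD2l lerN2; apply: le_trans (ler_norm _) _.
  by rewrite normrM -[leRHS]mulr1 ler_pM.
have taur0 : 0 < 1 - tau * rho by apply: lt_le_trans taur.
have v01 : 0 <= v <= 1.
  rewrite /v mulr_ge0 ?subr_ge0 //= -[leRHS]mulr1 ler_pM ?subr_ge0 //; lra.
have /andP[v0 v1] := v01.
(* For row sums [rho] and signed row sums [p], inserting [k + p * v * s] into the fixed-point
   equation leaves exactly the scalar equation [kE]. *)
pose k := tau * p ^+ 2 * v / (1 - tau * rho).
have kE : k = tau * (k * rho + p ^+ 2 * v).
  by rewrite /k; field; rewrite gt_eqF.
have k1 : `|k| <= lam^-1.
  rewrite /k normrM normfV (gtr0_norm taur0) -[leRHS]mul1r.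
  rewrite ler_pM ?invr_ge0 ?(ltW taur0) //; last by rewrite lef_pV2.
  rewrite normrM (ger0_norm v0) normrM (ger0_norm (sqr_ge0 p)).
  have pp : p ^+ 2 <= 1 by rewrite expr_le1.
  apply: mulr_ile1 => //; first by rewrite mulr_ge0 ?sqr_ge0.
  by apply: mulr_ile1; rewrite ?sqr_ge0.
exists k; rewrite -/c -/q -/v.
have -> : 30 * delta / (1 - L) ^+ 2 = (30 * delta / lam) / (1 - L).
  by rewrite /lam; field; rewrite gt_eqF.
apply: (@sup_contraction _ _ (fun i => q 0 i - k - p * v * s i)) => // M hM i.
have M0 : 0 <= M by apply: le_trans (hM i).
pose x : 'rV[R]_N := \row_j (q 0 j - k - p * v * s j).
have qA : (q *m A^T) 0 i = (x *m A^T) 0 i + k * \sum_j A i j + p * v * \sum_j A i j * s j.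
  rewrite !mxE !mulr_sumr -!big_split /=; apply: eq_bigr => j _; rewrite !mxE; ring.
(* Apart from the contracted term [tau * (x *m A^T) 0 i], the summands are at most
   [20 * delta / lam], [2 * delta], [4 * delta / lam], [2 * delta / lam] and [2 * delta], which adds
   up to [30 * delta / lam]. *)
have -> : q 0 i - k - p * v * s i =
   (q 0 i - c 0 i * Sg i i - L ^+ 2 * rho * (q *m A^T) 0 i)
   + tau * (x *m A^T) 0 i
   + (c 0 i - p * s i) * Sg i i + p * s i * (Sg i i - v)
   + tau * k * (\sum_j A i j - rho) + tau * (p * v) * (\sum_j A i j * s j - p).
  rewrite -/tau qA {1}kE; ring.
have h1 := profile_fixpoint i.
have h2 : `|tau * (x *m A^T) 0 i| <= L * M.
  rewrite normrM ler_pM //; rewrite -[leRHS]mulr1.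
  apply: norm_mulmx_row_le => //; first by move=> j; rewrite mxE; exact: hM.
  by under eq_bigr do rewrite mxE.
have h3 : `|(c 0 i - p * s i) * Sg i i| <= 2 * delta.
  by rewrite normrM -[leRHS]mulr1 ler_pM.
have h4 : `|p * s i * (Sg i i - v)| <= 4 * delta / lam.
  rewrite !normrM s1 mulr1 (ger0_norm p0) -[leRHS]mul1r ler_pM //.
  rewrite Sg_diag; apply: le_trans (profile_mean i).
  exact: bernoulli_variance_lipschitz.
have h5 : `|tau * k * (\sum_j A i j - rho)| <= 2 * delta / lam.
  have -> : 2 * delta / lam = 1 * lam^-1 * (2 * delta) by ring.
  by rewrite normrM (normrM tau k); apply: ler_pM => //; rewrite ler_pM.
have h6 : `|tau * (p * v) * (\sum_j A i j * s j - p)| <= 2 * delta.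
  have /andP[pv0 pv1] : 0 <= p * v <= 1 by rewrite mulr_ge0 // mulr_ile1.
  rewrite normrM (normrM tau (p * v)) (ger0_norm pv0) -[leRHS]mul1r.
  apply: ler_pM => //; first by rewrite mulr_ge0.
  by rewrite mulr_ile1.
have dl : delta <= delta / lam by rewrite ler_pdivlMr // ler_piMr ?(ltW d0) ?(ltW lam1).
do 5 (apply: (le_trans (ler_normD _ _)); rewrite -?lerBrDr).
lra.
Qed.

End profile.

(** * Empirical averages along a trajectory *)

Lemma spike_prob_range (R : realType) (N : nat) (lambda mu : R) (Pp : {set 'I_N})
    (t : 'M[bool]_N) (x : {ffun 'I_N -> bool}) (i : 'I_N) :
  0 <= lambda <= 1 -> 0 <= mu <= lambda -> 0 <= spike_prob lambda mu Pp t x i <= 1.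
Proof.
move=> /andP[l0 l1] /andP[m0 ml]; rewrite /spike_prob.
set u := _ + _ * _.
have hb (b c : bool) : 0 <= (b%:R * c%:R : R) <= 1 by case: b; case: c; rewrite ?mulr0 ?mulr1 /= ?ler01 ?lexx.
have hb' (b c : bool) : 0 <= (b%:R * (1 - c%:R) : R) <= 1.
  by case: b; case: c; rewrite ?subrr ?subr0 ?mulr0 ?mulr1 ?ler01 ?lexx.
suff /andP[u0 u1] : 0 <= u <= 1.
  apply/andP; split; first by rewrite addr_ge0 // mulr_ge0 // subr_ge0.
  have : (1 - lambda) * u <= 1 - lambda by rewrite ler_piMr // subr_ge0.
  lra.
rewrite /u -mulrDr; apply/andP; split.
  rewrite mulr_ge0 ?invr_ge0 //; apply: addr_ge0; apply: sumr_ge0 => j _.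
    by have /andP[] := hb (t i j) (x j).
  by have /andP[] := hb' (t i j) (x j).
have N0 : (0 < N)%N by apply: leq_ltn_trans (ltn_ord i).
rewrite mulrC ler_pdivrMr ?ltr0n // mul1r -(card_setC_natr R Pp).
rewrite -[#|Pp|%:R]sumr_const -[#|~: Pp|%:R]sumr_const lerD //; apply: ler_sum => j _.
  by have /andP[] := hb (t i j) (x j).
by have /andP[] := hb' (t i j) (x j).
Qed.

(* The three families of martingale increments behind the empirical mean, the
   off-diagonal empirical covariance and the lag-one empirical covariance. *)
Definition increment {R : realType} {N : nat} (lambda mu : R) (Pp : {set 'I_N})
    (t : 'M[bool]_N) (c : 'I_N + ('I_N * 'I_N + 'I_N * 'I_N))
    (x y : {ffun 'I_N -> bool}) : R :=
  let F := spike_prob lambda mu Pp t x in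
  match c with
  | inl i => (y i)%:R - F i
  | inr (inl (i, j)) =>
      if i == j then 0 else (y i)%:R * (y j)%:R - F i * F j
  | inr (inr (i, j)) => ((y j)%:R - F j) * (x i)%:R
  end.

(* [c = (along a row?, over the plus community?, index of the row or column)] *)
Definition half_sum_dev {R : realType} {N : nat} (p : R) (Pp : {set 'I_N})
    (t : 'M[bool]_N) (c : bool * bool * 'I_N) : R :=
  \sum_(j in if c.1.2 then Pp else ~: Pp)
     ((if c.1.1 then t c.2 j else t j c.2)%:R - p).

Section path_average.
Variables (R : realType) (N T : nat).
Variables (lambda mu p : R) (Pp : {set 'I_N}) (t : 'M[bool]_N).
Variable z : nat -> {ffun 'I_N -> bool}.
Hypothesis N0 : (0 < N)%N.
Hypothesis T0 : (0 < T)%N.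
Hypothesis lambda01 : 0 < lambda < 1.
Hypothesis mu_range : 0 < mu <= lambda.

Let Z k i : R := (z k i)%:R.
Let F k i : R := spike_prob lambda mu Pp t (z k) i.
Let L := 1 - lambda.
(** The signed interaction matrix: a minus component [j] enters through [1 - x j], whose variable
    part has sign -1 and whose constant part is collected in [a]. *)
Let A : 'M[R]_N := \matrix_(i, j) (N%:R^-1 * (t i j)%:R * side R Pp j).
Let a i := mu + L * (N%:R^-1 * \sum_(j in ~: Pp) (t i j)%:R).
Let avg (f : nat -> R) := T%:R^-1 * \sum_(k < T) f k.
Let m i := avg (Z^~ i).
Let Sg : 'M[R]_N := \matrix_(i, j) (avg (fun k => Z k i * Z k j) - m i * m j).
(** Observations are numbered from 1 and the states [z] from 0. *)
Let Y n : 'cV[R]_N := \col_i (z n.-1 i)%:R.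

Let TR0 : 0 < T%:R :> R. Proof. by rewrite ltr0n. Qed.
Let NR0 : 0 < N%:R :> R. Proof. by rewrite ltr0n. Qed.

Let Z01 k i : 0 <= Z k i <= 1. Proof. by rewrite /Z; case: (z k i); rewrite ?ler01 ?lexx. Qed.

Let F01 k i : 0 <= F k i <= 1.
Proof.
have /andP[? ?] := lambda01; have /andP[? ?] := mu_range.
by apply: spike_prob_range; apply/andP; split; lra.
Qed.

Let FE k i : F k i = a i + L * \sum_j A i j * Z k j.
Proof.
rewrite /F /spike_prob -/L /a -addrA -[in RHS]mulrDr; congr (mu + L * _).
have e1 : \sum_(j in Pp) A i j * Z k j =
    N%:R^-1 * \sum_(j in Pp) (t i j)%:R * (z k j)%:R.
  by rewrite mulr_sumr; apply: eq_bigr => j jP; rewrite mxE /side jP mulr1 mulrA.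
have e2 : \sum_(j in ~: Pp) A i j * Z k j =
    N%:R^-1 * (\sum_(j in ~: Pp) (t i j)%:R * (1 - (z k j)%:R))
    - N%:R^-1 * \sum_(j in ~: Pp) (t i j)%:R.
  rewrite -mulrBr -sumrB mulr_sumr; apply: eq_bigr => j; rewrite inE => /negbTE jP.
  by rewrite mxE /side jP /Z; ring.
rewrite [X in _ = _ + X](bigID (mem Pp)) /= e1.
have -> : \sum_(j | j \notin Pp) A i j * Z k j = \sum_(j in ~: Pp) A i j * Z k j.
  by apply: eq_bigl => j; rewrite inE.
rewrite e2; ring.
Qed.

Let avgD f g : avg (fun k => f k + g k) = avg f + avg g.
Proof. by rewrite /avg big_split mulrDr. Qed.
Let avgB f g : avg (fun k => f k - g k) = avg f - avg g.
Proof. by rewrite /avg sumrB mulrBr. Qed.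
Let avgZ c f : avg (fun k => c * f k) = c * avg f.
Proof. by rewrite /avg -mulr_sumr mulrCA. Qed.
Let avgC c : avg (fun=> c) = c.
Proof. by rewrite /avg sumr_const card_ord -[c *+ T]mulr_natl mulKf // gt_eqF. Qed.
Let avg_sum (I : finType) (f : I -> nat -> R) :
  avg (fun k => \sum_i f i k) = \sum_i avg (f i).
Proof. by rewrite /avg exchange_big mulr_sumr. Qed.
Let eq_avg f g : (forall k, f k = g k) -> avg f = avg g.
Proof. by move=> fg; rewrite /avg; under eq_bigr do rewrite fg. Qed.
Let avg01 f : (forall k, 0 <= f k <= 1) -> 0 <= avg f <= 1.
Proof.
move=> f01; apply/andP; split.
  by rewrite mulr_ge0 ?invr_ge0 // sumr_ge0 // => k _; have /andP[] := f01 k.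
rewrite -[leRHS](avgC 1) ler_wpM2l ?invr_ge0 // ler_sum // => k _.
by have /andP[] := f01 k.
Qed.
(** The difference telescopes to [(f T - f 0) / T]. *)
Let avg_shift f : (forall k, 0 <= f k <= 1) ->
  `|avg (fun k => f k.+1) - avg f| <= T%:R^-1.
Proof.
move=> f01; rewrite -avgB /avg.
rewrite -(big_mkord xpredT (fun k => f k.+1 - f k)) telescope_sumr //.
rewrite normrM normfV (gtr0_norm TR0) ler_piMr ?invr_ge0 //.
have /andP[? ?] := f01 T; have /andP[? ?] := f01 0%N.
by rewrite ler_norml; apply/andP; split; lra.
Qed.

Let m01 i : 0 <= m i <= 1. Proof. by apply: avg01 => k; exact: Z01. Qed.
Let fb i := avg (F^~ i).
Let fb01 i : 0 <= fb i <= 1. Proof. by apply: avg01 => k; exact: F01. Qed.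

Let fbE i : fb i = a i + L * \sum_j A i j * m j.
Proof.
rewrite /fb (eq_avg (g := fun k => a i + L * \sum_j A i j * Z k j)); last by move=> k; exact: FE.
rewrite avgD avgC avgZ avg_sum; congr (_ + _ * _).
by apply: eq_bigr => j _; rewrite avgZ.
Qed.

(** An exact identity: [F] is affine in [Z] along the trajectory, with linear part [L * A]. The same
    argument in the other variable gives [cov_FF]. *)
Let cov_FZ j i : avg (fun k => F k j * Z k i) - fb j * m i = L * (A *m Sg) j i.
Proof.
rewrite mxE fbE.
rewrite (eq_avg (g := fun k => a j * Z k i + L * \sum_l A j l * (Z k l * Z k i))); last first.
  move=> k; rewrite FE mulrDl -!mulrA; congr (_ + _ * _).
  by rewrite mulr_suml; apply: eq_bigr => l _; rewrite mulrA.
rewrite avgD !avgZ avg_sum -/(m i).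
have -> : \sum_l A j l * Sg l i = (\sum_l avg (fun k => A j l * (Z k l * Z k i)))
    - (\sum_l A j l * m l) * m i.
  rewrite mulr_suml -sumrB; apply: eq_bigr => l _; rewrite [Sg _ _]mxE avgZ; ring.
ring.
Qed.

Let cov_FF i j : avg (fun k => F k i * F k j) - fb i * fb j = L ^+ 2 * (A *m Sg *m A^T) i j.
Proof.
have -> : (A *m Sg *m A^T) i j = \sum_l (A *m Sg) i l * A j l.
  by rewrite mxE; apply: eq_bigr => l _; rewrite [A^T _ _]mxE.
rewrite (fbE j) (eq_avg (g := fun k => a j * F k i + L * \sum_l A j l * (F k i * Z k l))); last first.
  move=> k; rewrite (FE k j) mulrDr [a j * _]mulrC; congr (_ + _).
  by rewrite mulrCA mulr_sumr; congr (_ * _); apply: eq_bigr => l _; rewrite mulrCA.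
rewrite avgD !avgZ avg_sum -/(fb i).
have e : L * (\sum_l (A *m Sg) i l * A j l) =
    (\sum_l avg (fun k => A j l * (F k i * Z k l))) - fb i * (\sum_l A j l * m l).
  rewrite !mulr_sumr -sumrB; apply: eq_bigr => l _.
  by rewrite avgZ mulrA -cov_FZ; ring.
rewrite expr2 -mulrA e; ring.
Qed.


(** * Consequences of small martingale averages *)

Variables e delta : R.
Hypothesis T_large : N%:R <= e * T%:R.
Hypothesis increments_small : forall c,
  `|\sum_(k < T) increment lambda mu Pp t c (z k) (z k.+1)| <= e / N%:R * T%:R.

Let avg_one i : `|\sum_(k < T) (Z k.+1 i - F k i)| <= e / N%:R * T%:R.
Proof. exact: (increments_small (inl i)). Qed.

Let avg_two i j : i != j ->
  `|\sum_(k < T) (Z k.+1 i * Z k.+1 j - F k i * F k j)| <= e / N%:R * T%:R.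
Proof. by move=> /negbTE ij; have := increments_small (inr (inl (i, j))); rewrite /= ij. Qed.

Let avg_lag i j : `|\sum_(k < T) ((Z k.+1 j - F k j) * Z k i)| <= e / N%:R * T%:R.
Proof. exact: (increments_small (inr (inr (i, j)))). Qed.

Let norm_avg_le (f : nat -> R) b : `|\sum_(k < T) f k| <= b * T%:R -> `|avg f| <= b.
Proof. by rewrite /avg normrM normfV (gtr0_norm TR0) ler_pdivrMl // mulrC. Qed.

Let mshift i := avg (fun k => Z k.+1 i).

Let invT_le : T%:R^-1 <= e / N%:R.
Proof. by rewrite ler_pdivlMr // ler_pdivrMl // mulrC. Qed.

Let mshift_m i : `|mshift i - m i| <= e / N%:R.
Proof. by apply: le_trans invT_le; apply: (avg_shift (f := Z^~ i)) => k; exact: Z01. Qed.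

Let mshift_fb i : `|mshift i - fb i| <= e / N%:R.
Proof. by rewrite /mshift /fb -avgB; apply: norm_avg_le; exact: avg_one. Qed.

Let m_fb i : `|m i - fb i| <= 2 * (e / N%:R).
Proof.
have := mshift_m i; have := mshift_fb i.
by rewrite !ler_norml => /andP[? ?] /andP[? ?]; apply/andP; split; lra.
Qed.

(** The error is [e / N] for shifting time by one, [e / N] for the martingale average of products,
    and [4 * e / N] for replacing [m] by [fb] in both factors. *)
Let Sg_off i j : i != j ->
  `|Sg i j - L ^+ 2 * (A *m Sg *m A^T) i j| <= 6 * e / N%:R.
Proof.
move=> ij; rewrite -cov_FF [Sg i j]mxE.
have h1 : `|avg (fun k => Z k.+1 i * Z k.+1 j) - avg (fun k => Z k i * Z k j)| <= e / N%:R.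
  apply: le_trans invT_le; apply: (avg_shift (f := fun k => Z k i * Z k j)) => k.
  have /andP[? ?] := Z01 k i; have /andP[? ?] := Z01 k j.
  by rewrite mulr_ge0 // mulr_ile1.
have h2 : `|avg (fun k => Z k.+1 i * Z k.+1 j) - avg (fun k => F k i * F k j)| <= e / N%:R.
  by rewrite -avgB; apply: norm_avg_le; exact: avg_two.
have h3 : `|m i * m j - fb i * fb j| <= 4 * (e / N%:R).
  have -> : m i * m j - fb i * fb j = m i * (m j - fb j) + (m i - fb i) * fb j by ring.
  have /andP[? ?] := m01 i; have /andP[? ?] := fb01 j.
  apply: (le_trans (ler_normD _ _)); rewrite (normrM (m i)) (normrM (m i - fb i)).
  rewrite (ger0_norm (x := m i)) // (ger0_norm (x := fb j)) //.
  have : m i * `|m j - fb j| <= `|m j - fb j| by rewrite ler_piMl.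
  have : `|m i - fb i| * fb j <= `|m i - fb i| by rewrite ler_piMr.
  have := m_fb i; have := m_fb j; lra.
move: h1 h2 h3; rewrite !ler_norml => /andP[? ?] /andP[? ?] /andP[? ?].
by apply/andP; split; lra.
Qed.

Let Sg_diag i : Sg i i = m i * (1 - m i).
Proof.
rewrite mxE (eq_avg (g := Z^~ i)) => [|k]; last first.
  by rewrite /Z; case: (z k i); rewrite ?mulr1 ?mulr0.
rewrite -/(m i); ring.
Qed.

Let mhatE j : mhat Y T j 0 = m j.
Proof.
rewrite mxE summxE big_add1 /= big_mkord; congr (_ * _).
by apply: eq_bigr => k _; rewrite mxE.
Qed.

Let sigma_agE i :
  sigma_ag Y T i 0 = \sum_j (avg (fun k => Z k.+1 j * Z k i) - mshift j * m i).
Proof.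
rewrite mxE; apply: eq_bigr => j _.
rewrite [const_mx 1 _ _]mxE mulr1 [_^T _ _]mxE mxE summxE big_add1 /= big_mkord.
transitivity (avg (fun k => (Z k.+1 j - m j) * (Z k i - m i))).
  congr (_ * _); apply: eq_bigr => k _; rewrite mxE big_ord1 [_^T _ _]mxE.
  have E (u : 'cV[R]_N) n l : (u - mhat Y T) l n = u l 0 - m l by rewrite ord1 -mhatE !mxE.
  by rewrite !E !mxE.
(* Centring [Z k.+1 j] at [m j] instead of its own average [mshift j] changes nothing, as
   [Z k i - m i] averages to zero. *)
rewrite (eq_avg (g := fun k => (Z k.+1 j * Z k i - m i * Z k.+1 j)
  - m j * (Z k i - m i))); last by move=> k; ring.
rewrite !avgB !avgZ avgB avgC -/(mshift j) -/(m i); ring.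
Qed.

(** Each of the [N] summands of [sigma_agE] has error [2 * e / N]: one half from the lagged
    products, one half from the means. This is why averages must be controlled at scale [e / N]. *)
Let sigma_ag_close i :
  `|sigma_ag Y T i 0 - L * ((const_mx 1 : 'rV[R]_N) *m A *m Sg) 0 i| <= 2 * e.
Proof.
have -> : ((const_mx 1 : 'rV[R]_N) *m A *m Sg) 0 i = \sum_j (A *m Sg) j i.
  by rewrite -mulmxA mxE; apply: eq_bigr => j _; rewrite mxE mul1r.
rewrite sigma_agE mulr_sumr -sumrB; apply: (le_trans (ler_norm_sum _ _ _)).
apply: (@le_trans _ _ (\sum_(j < N) 2 * e / N%:R)); last first.
  by rewrite sumr_const card_ord -[leLHS]mulr_natl mulrC divfK // gt_eqF.
apply: ler_sum => j _; rewrite -cov_FZ.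
have h1 : `|avg (fun k => Z k.+1 j * Z k i) - avg (fun k => F k j * Z k i)| <= e / N%:R.
  rewrite -avgB; apply: norm_avg_le.
  by rewrite (eq_bigr (fun k : 'I_T => (Z k.+1 j - F k j) * Z k i)) // => k _; ring.
have h2 : `|(mshift j - fb j) * m i| <= e / N%:R.
  have /andP[? ?] := m01 i; rewrite normrM (ger0_norm (x := m i)) //.
  by apply: le_trans (mshift_fb j); rewrite ler_piMr.
have -> : 2 * e / N%:R = e / N%:R + e / N%:R by ring.
apply: le_trans (lerD h1 h2); apply: le_trans (ler_normB _ _).
by rewrite le_eqVlt; apply/orP; left; apply/eqP; congr `|_|; ring.
Qed.

(** * Regular row and column sums of [theta], and the profile of [sigma_ag] *)

Hypothesis p01 : 0 <= p <= 1.
Hypothesis delta01 : 0 < delta <= 1.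
Hypothesis e_delta : 6 * e <= delta.
Hypothesis N_large : 3 <= lambda * delta * N%:R.
Hypothesis half_sums_close : forall c, `|half_sum_dev p Pp t c| <= delta * N%:R.

Let rP : R := #|Pp|%:R / N%:R.
Let rM : R := #|~: Pp|%:R / N%:R.
Let rho := p * (rP - rM).

Let rPM : rP + rM = 1.
Proof. by rewrite /rP /rM -mulrDl card_setC_natr divff // gt_eqF. Qed.
Let rP0 : 0 <= rP. Proof. by rewrite divr_ge0. Qed.
Let rM0 : 0 <= rM. Proof. by rewrite divr_ge0. Qed.

Let signed_sum (u : 'I_N -> R) :
  `|\sum_(j in Pp) u j| <= delta * N%:R -> `|\sum_(j in ~: Pp) u j| <= delta * N%:R ->
  `|N%:R^-1 * \sum_j u j| <= 2 * delta /\ `|N%:R^-1 * \sum_j side R Pp j * u j| <= 2 * delta.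
Proof.
move=> h1 h2.
have split (w : 'I_N -> R) : \sum_j w j = \sum_(j in Pp) w j + \sum_(j in ~: Pp) w j.
  by rewrite (bigID (mem Pp)) /=; congr (_ + _); apply: eq_bigl => j; rewrite inE.
have E : \sum_j side R Pp j * u j = \sum_(j in Pp) u j - \sum_(j in ~: Pp) u j.
  rewrite split -sumrN; congr (_ + _); apply: eq_bigr => j; rewrite /side ?inE.
    by move=> ->; rewrite mul1r.
  by move=> /negbTE ->; rewrite mulN1r.
rewrite E split !normrM normfV (gtr0_norm NR0) !(mulrC N%:R^-1) !ler_pdivrMr //.
by split; [apply: (le_trans (ler_normD _ _))|apply: (le_trans (ler_normB _ _))]; lra.
Qed.

Let sum_side_p : \sum_j side R Pp j * p = N%:R * rho.
Proof.
rewrite -mulr_suml sum_side /rho /rP /rM; field; rewrite gt_eqF //.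
Qed.

Let row_bounds i := signed_sum
  (half_sums_close (true, true, i)) (half_sums_close (true, false, i)).
Let col_bounds j := signed_sum
  (half_sums_close (false, true, j)) (half_sums_close (false, false, j)).

Let sum_p : \sum_(j < N) p = N%:R * p.
Proof. by rewrite sumr_const card_ord mulr_natl. Qed.

Let A_row i : `|\sum_j A i j - rho| <= 2 * delta.
Proof.
have [_] := row_bounds i; congr (`|_| <= _).
under eq_bigr do rewrite mulrBr; rewrite sumrB sum_side_p mulrBr mulKf ?gt_eqF //.
congr (_ - _); rewrite mulr_sumr; apply: eq_bigr => j _; rewrite mxE; ring.
Qed.

Let side_sq j : side R Pp j * side R Pp j = 1.
Proof. by rewrite /side; case: ifP; rewrite ?mulr1 // mulrN1 opprK. Qed.

Let A_row_s i : `|\sum_j A i j * side R Pp j - p| <= 2 * delta.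
Proof.
have [+ _] := row_bounds i; congr (`|_| <= _).
rewrite sumrB sum_p mulrBr mulKf ?gt_eqF //.
congr (_ - _); rewrite mulr_sumr; apply: eq_bigr => j _.
by rewrite mxE -[RHS]mulrA side_sq mulr1.
Qed.

Let norm_mul_side j (x : R) : `|x * side R Pp j| = `|x|.
Proof. by rewrite normrM norm_side mulr1. Qed.

Let A_col j : `|\sum_i A i j - p * side R Pp j| <= 2 * delta.
Proof.
have [+ _] := col_bounds j.
(* Column [j] of [A] carries the sign of [j], so the bound on the column of [theta] is multiplied by
   that sign. *)
rewrite -[X in X <= _](norm_mul_side j); congr (`|_| <= _).
rewrite sumrB sum_p mulrBr mulKf ?gt_eqF // mulrBl; congr (_ - _).
by rewrite mulr_sumr mulr_suml; apply: eq_bigr => i _; rewrite mxE.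
Qed.

Let A_col_s j : `|\sum_i side R Pp i * A i j - rho * side R Pp j| <= 2 * delta.
Proof.
have [_] := col_bounds j.
rewrite -[X in X <= _](norm_mul_side j); congr (`|_| <= _).
under eq_bigr do rewrite mulrBr; rewrite sumrB sum_side_p mulrBr mulKf ?gt_eqF //.
rewrite mulrBl; congr (_ - _).
by rewrite mulr_sumr mulr_suml; apply: eq_bigr => i _; rewrite mxE; ring.
Qed.

Let A_le i j : `|A i j| <= N%:R^-1.
Proof.
rewrite mxE !normrM norm_side mulr1 normfV (gtr0_norm NR0) ler_piMr ?invr_ge0 //.
by case: (t i j); rewrite ?normr1 ?normr0.
Qed.

(** The solution [x] of [x = mu + L * p * rM + L * rho * x], the mean equation with [theta] averaged
    out. It uses the actual community fractions at size [N], not their limits. *)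
Definition limit_mean : R := (mu + L * p * rM) / (1 - L * rho).

(** Places [limit_mean] in [[0, 1]]: the sum of [mu + L * p * rM] and [L * rho] is
    [mu + L * p * rP], at most [lambda + L = 1]. *)
Let Lrho : 0 < 1 - L * rho /\ 0 <= mu + L * p * rM /\ mu + L * p * rM <= 1 - L * rho.
Proof.
have /andP[? ?] := lambda01; have /andP[? ?] := mu_range; have /andP[? ?] := p01.
have LE : L = 1 - lambda by [].
have L0 : 0 <= L by rewrite subr_ge0; exact: ltW.
have h1 : 0 < mu + L * p * rM.
  by apply: ltr_wpDr => //; apply: mulr_ge0 => //; exact: mulr_ge0.
suff h2 : mu + L * p * rM <= 1 - L * rho by split; [exact: lt_le_trans h2|split => //; exact: ltW].
have rP1 : rP <= 1 by have := rPM; have := rM0; lra.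
have h3 : p * rP <= 1 by rewrite mulr_ile1.
have h4 : L * (p * rP) <= L by rewrite ler_piMr.
have : L * rho + L * p * rM = L * (p * rP) by rewrite /rho; ring.
lra.
Qed.

(** The estimates above supply the hypotheses of [covariance_profile], whose error
    [30 * delta / lambda ^+ 2] is joined by [2 * e <= delta] from [sigma_ag_close]. *)
Lemma sigma_ag_profile : exists b, forall i,
  `|sigma_ag Y T i 0 - b - L * (p * (limit_mean * (1 - limit_mean))) * side R Pp i|
  <= 31 * delta / lambda ^+ 2.
Proof.
have /andP[l0 l1] := lambda01; have /andP[? ?] := p01; have /andP[d0 d1] := delta01.
have [lr0 [al0 al1]] := Lrho.
have LE : 1 - L = lambda by rewrite /L; ring.
have L0 : 0 < L by rewrite /L; lra.
have L1 : L < 1 by rewrite /L; lra.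
have rho1 : `|rho| <= 1.
  rewrite /rho normrM (ger0_norm (x := p)) // mulr_ile1 //.
  by have := rPM; have := rP0; have := rM0; rewrite ler_norml => *; apply/andP; split; lra.
have ms01 : 0 <= limit_mean <= 1.
  by rewrite /limit_mean divr_ge0 ?(ltW lr0) //= ler_pdivrMr // mul1r.
have ed := e_delta.
have eN : e / N%:R <= e.
  have e0 : 0 <= e by rewrite -(pmulr_lge0 _ TR0); apply: le_trans T_large.
  by rewrite ler_pdivrMr // ler_peMr // ler1n.
have a_close i : `|a i - (mu + L * p * rM)| <= delta.
  have -> : a i - (mu + L * p * rM) = L * (N%:R^-1 * \sum_(j in ~: Pp) ((t i j)%:R - p)).
    rewrite sumrB sumr_const -[p *+ _]mulr_natl /a /rM; field; rewrite gt_eqF //.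
  rewrite !normrM normfV (gtr0_norm NR0) (gtr0_norm L0).
  have h : N%:R^-1 * `|\sum_(j in ~: Pp) ((t i j)%:R - p)| <= delta.
    by rewrite mulrC ler_pdivrMr //; exact: (half_sums_close (true, false, i)).
  by apply: le_trans h; rewrite ler_piMl ?(ltW L1) // mulr_ge0 ?invr_ge0.
have meq i : `|m i - (limit_mean * (1 - L * rho) + L * \sum_j A i j * m j)| <= 2 * delta.
  have -> : limit_mean * (1 - L * rho) = mu + L * p * rM by rewrite divfK // gt_eqF.
  have := m_fb i; have := a_close i; rewrite fbE !ler_norml => /andP[? ?] /andP[? ?].
  by apply/andP; split; lra.
have Soff i j : i != j -> `|Sg i j - L ^+ 2 * (A *m Sg *m A^T) i j| <= delta / N%:R.
  by move=> ij; apply: (le_trans (Sg_off ij)); rewrite ler_pM2r ?invr_gt0.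
have NL : 3 <= (1 - L) * delta * N%:R by rewrite LE.
have [k hk] := covariance_profile N0 L0 L1 p01 rho1 delta01 NL (norm_side R Pp) A_le
  A_row A_row_s A_col A_col_s ms01 m01 meq Sg_diag Soff.
exists (L * k) => i.
have := hk i; have := sigma_ag_close i; rewrite LE.
set q := (_ *m Sg) 0 i; set w := p * _; set u := side R Pp i => h1 h2.
have h3 : `|L * (q - k - w * u)| <= 30 * delta / lambda ^+ 2.
  by rewrite normrM (gtr0_norm L0); apply: le_trans h2; rewrite ler_piMl ?(ltW L1).
have h4 : delta <= delta / lambda ^+ 2.
  by rewrite ler_pdivlMr ?exprn_gt0 // ler_piMr ?(ltW d0) // expr_le1 ?ltW.
have -> : sigma_ag Y T i 0 - L * k - L * w * u =
  (sigma_ag Y T i 0 - L * q) + L * (q - k - w * u) by ring.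
by apply: (le_trans (ler_normD _ _)); lra.
Qed.

End path_average.

(** * Moments of products of Bernoulli laws *)

Lemma prod_bernoulli_sum (R : realType) (I : finType) (r : I -> R) (u : I -> bool -> R) :
  \sum_(y : {ffun I -> bool}) (\prod_i bernoulli_pmf (r i) (y i)) * \prod_i u i (y i)
  = \prod_i (r i * u i true + (1 - r i) * u i false).
Proof.
transitivity (\prod_i \sum_b bernoulli_pmf (r i) b * u i b).
  by rewrite bigA_distr_bigA; apply: eq_bigr => y _; rewrite big_split.
by apply: eq_bigr => i _; rewrite big_bool.
Qed.

Lemma prod_bernoulli_moment (R : realType) (I : finType) (r : I -> R) (B : {set I}) :
  \sum_(y : {ffun I -> bool}) (\prod_i bernoulli_pmf (r i) (y i)) * \prod_(i in B) (y i)%:R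
  = \prod_(i in B) r i.
Proof.
have H := prod_bernoulli_sum r (fun i b => if i \in B then b%:R else 1).
rewrite [RHS]big_mkcond.
have -> : \sum_(y : {ffun I -> bool})
    (\prod_i bernoulli_pmf (r i) (y i)) * \prod_(i in B) (y i)%:R =
    \prod_i (r i * (if i \in B then true%:R else 1)
      + (1 - r i) * (if i \in B then false%:R else 1)).
  by rewrite -H; apply: eq_bigr => y _; congr (_ * _); rewrite big_mkcond.
apply: eq_bigr => i _; case: ifP => _; last by ring.
by rewrite mulr1 mulr0 addr0.
Qed.

Lemma sum_union_le (R : realType) (E I : finType) (q : E -> R) (b : pred E)
    (c : I -> pred E) :
  (forall e, 0 <= q e) -> (forall e, b e -> exists i, c i e) ->
  \sum_(e | b e) q e <= \sum_i \sum_(e | c i e) q e.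
Proof.
move=> q0 bc; under [leRHS]eq_bigr do rewrite big_mkcond.
rewrite exchange_big big_mkcond /=; apply: ler_sum => e _.
have h0 i : 0 <= (if c i e then q e else 0) by case: ifP.
case: ifP => [/bc[i ci]|_]; last exact: sumr_ge0.
by rewrite (bigD1 i) //= ci lerDl sumr_ge0.
Qed.

Section transition_moments.
Variables (R : realType) (N : nat) (lambda mu : R) (Pp : {set 'I_N}) (t : 'M[bool]_N).
Hypothesis lambda01 : 0 <= lambda <= 1.
Hypothesis mu_range : 0 <= mu <= lambda.
Let S := {ffun 'I_N -> bool}.
Let Q : S -> S -> R := transition lambda mu Pp t.
Let F (x : S) i : R := spike_prob lambda mu Pp t x i.

Lemma transition_ge0 x y : 0 <= Q x y.
Proof. by apply: prodr_ge0 => i _; apply: bernoulli_pmf_ge0; exact: spike_prob_range. Qed.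

Let transition_moment x (B : {set 'I_N}) :
  \sum_y Q x y * \prod_(i in B) (y i)%:R = \prod_(i in B) F x i.
Proof. exact: prod_bernoulli_moment. Qed.

Lemma transition_sum1 x : \sum_y Q x y = 1.
Proof.
have := transition_moment x finset.set0; rewrite big_set0 => <-.
by apply: eq_bigr => y _; rewrite big_set0 mulr1.
Qed.

Lemma transition_mean x i : \sum_y Q x y * (y i)%:R = F x i.
Proof.
have := transition_moment x [set i]%SET; rewrite big_set1 => <-.
by apply: eq_bigr => y _; rewrite big_set1.
Qed.

Lemma transition_mean2 x i j : i != j ->
  \sum_y Q x y * ((y i)%:R * (y j)%:R) = F x i * F x j.
Proof.
move=> ij; have := transition_moment x [set i; j]%SET.
rewrite big_setU1 /= ?inE // big_set1 => <-.
by apply: eq_bigr => y _; rewrite big_setU1 /= ?inE // big_set1.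
Qed.

(** Given [x], the coordinates of [y] are independent with means [F x], and [x i] is a constant. In
    the second family the case [i = j] is set to zero because [(y i) ^+ 2 = y i] has mean [F x i],
    not its square. *)
Lemma increment_centered c x : \sum_y Q x y * increment lambda mu Pp t c x y = 0.
Proof.
case: c => [i|[[i j]|[i j]]] /=.
- under eq_bigr do rewrite mulrBr; rewrite sumrB transition_mean -mulr_suml.
  by rewrite transition_sum1 mul1r subrr.
- have [_|ij] := eqVneq i j; first by rewrite big1 // => y _; rewrite mulr0.
  under eq_bigr do rewrite mulrBr; rewrite sumrB transition_mean2 // -mulr_suml.
  by rewrite transition_sum1 mul1r subrr.
- under eq_bigr do rewrite mulrA; rewrite -mulr_suml.
  under eq_bigr do rewrite mulrBr; rewrite sumrB transition_mean -mulr_suml.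
  by rewrite transition_sum1 mul1r subrr mul0r.
Qed.

Let norm_diff_le1 (u v : R) : 0 <= u <= 1 -> 0 <= v <= 1 -> `|u - v| <= 1.
Proof.
by move=> /andP[? ?] /andP[? ?]; rewrite ler_norml; apply/andP; split; lra.
Qed.

Let bool01 (b : bool) : 0 <= (b%:R : R) <= 1.
Proof. by case: b; rewrite ?ler01 ?lexx. Qed.

Let F01 x i : 0 <= F x i <= 1. Proof. exact: spike_prob_range. Qed.

Let mul01 (u v : R) : 0 <= u <= 1 -> 0 <= v <= 1 -> 0 <= u * v <= 1.
Proof. by move=> /andP[? ?] /andP[? ?]; rewrite mulr_ge0 // mulr_ile1. Qed.

Lemma increment_le1 c x y : `|increment lambda mu Pp t c x y| <= 1.
Proof.
case: c => [i|[[i j]|[i j]]] /=; first exact: norm_diff_le1.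
  by case: ifP => _; rewrite ?normr0 // norm_diff_le1 ?mul01.
rewrite normrM mulr_ile1 ?norm_diff_le1 //.
by case: (x i); rewrite ?normr1 ?normr0.
Qed.

End transition_moments.

(** * Concentration of partial row and column sums of [theta] *)

Lemma matrix_bernoulli_sum (R : realType) (N : nat) (p : R)
    (u : 'I_N * 'I_N -> bool -> R) :
  \sum_(t : 'M[bool]_N) (\prod_(i < N) \prod_(j < N) bernoulli_pmf p (t i j)) *
     \prod_ij u ij (t ij.1 ij.2)
  = \prod_ij (p * u ij true + (1 - p) * u ij false).
Proof.
rewrite -(prod_bernoulli_sum (fun=> p) u).
rewrite (reindex (fun f : {ffun 'I_N * 'I_N -> bool} => \matrix_(i, j) f (i, j))); last first.
  apply: onW_bij; exists (fun t : 'M[bool]_N => [ffun ij => t ij.1 ij.2]) => [f|t].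
    by apply/ffunP => -[i j]; rewrite ffunE mxE.
  by apply/matrixP => i j; rewrite mxE ffunE.
apply: eq_bigr => f _; congr (_ * _).
  by rewrite pair_bigA /=; apply: eq_bigr => -[i j] _; rewrite mxE.
by apply: eq_bigr => -[i j] _; rewrite mxE.
Qed.

Lemma matrix_bernoulli_sum1 (R : realType) (N : nat) (p : R) :
  \sum_(t : 'M[bool]_N) \prod_(i < N) \prod_(j < N) bernoulli_pmf p (t i j) = 1.
Proof.
have e1 : \prod_(ij : 'I_N * 'I_N) (p * 1 + (1 - p) * 1) = 1.
  by rewrite big1 // => ij _; rewrite !mulr1 addrC subrK.
rewrite -[RHS]e1 -(matrix_bernoulli_sum p (fun _ _ => 1)).
by apply: eq_bigr => t _; rewrite [X in _ * X]big1 // mulr1.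
Qed.

(** Injectivity of [phi] makes the entries distinct, hence independent: the exponential moment
    factors over all entries, with at most [N] factors different from 1. Rows and columns are both
    covered. *)
Lemma theta_tail (R : realType) (N : nat) (p a : R) (phi : 'I_N -> 'I_N * 'I_N)
    (B : {set 'I_N}) :
  0 <= p <= 1 -> injective phi -> (0 < N)%N -> 0 <= a <= 2 * N%:R ->
  \sum_(t : 'M[bool]_N | a <= `|\sum_(j in B) ((t (phi j).1 (phi j).2)%:R - p)|)
     \prod_(i < N) \prod_(j < N) bernoulli_pmf p (t i j)
  <= 2 * expR (- (a ^+ 2 / (8 * N%:R))).
Proof.
move=> p01 phi_inj N0 ha; have /andP[p0 p1] := p01.
pose w (t : 'M[bool]_N) := \prod_(i < N) \prod_(j < N) bernoulli_pmf p (t i j).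
pose Z (t : 'M[bool]_N) := \sum_(j in B) ((t (phi j).1 (phi j).2)%:R - p).
rewrite -[X in X * expR _]mulr1.
apply: (@chernoff_two_sided _ _ w Z) => //; rewrite ?ltr0n //.
  by move=> t; apply: prodr_ge0 => i _; apply: prodr_ge0 => j _; exact: bernoulli_pmf_ge0.
move=> s s1; rewrite mul1r.
pose B' := phi @: B.
have cB : #|B'|%:R <= N%:R :> R.
  rewrite ler_nat; apply: (leq_trans (leq_imset_card _ _)).
  by rewrite -[leqRHS]card_ord max_card.
have -> : \sum_t w t * expR (s * Z t) = \prod_ij
    (p * (if ij \in B' then expR (s * (true%:R - p)) else 1)
     + (1 - p) * (if ij \in B' then expR (s * (false%:R - p)) else 1)).
  rewrite -(matrix_bernoulli_sum p
    (fun ij b => if ij \in B' then expR (s * (b%:R - p)) else 1)).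
  apply: eq_bigr => t _; congr (_ * _).
  rewrite -big_mkcond /= mulr_sumr expR_sum big_imset //=; exact: in2W.
apply: (@le_trans _ _ (\prod_(ij : 'I_N * 'I_N) (if ij \in B' then expR (2 * s ^+ 2) else 1))).
  apply: ler_prod => ij _; case: ifP => _; last by rewrite !mulr1 addrC subrK ler01 lexx.
  rewrite addr_ge0 ?mulr_ge0 ?expR_ge0 ?subr_ge0 //=.
  have := @mgf_centered_le R bool (bernoulli_pmf p) (fun b => b%:R - p) s.
  rewrite !big_bool /=; apply=> //.
  - by move=> b; exact: bernoulli_pmf_ge0.
  - by ring.
  - by ring.
  - by case; rewrite ler_norml; apply/andP; split; rewrite /=; lra.
rewrite -big_mkcond prodr_const -expRM_natr ler_expR ler_wpM2l //.
by rewrite mulr_ge0 ?sqr_ge0.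
Qed.

(** * Law of the trajectory *)

(** Finite additivity over the values of [W], by induction on a list of distinct values; it turns
    probabilities into finite sums of reals. *)
Lemma probability_preimage_sum (R : realType) (d : measure_display)
    (Omega : measurableType d) (P : probability Omega R) (E : finType)
    (W : Omega -> E) (D : set Omega) (b : pred E) :
  measurable D -> (forall e, measurable [set w | W w = e]) ->
  P (D `&` [set w | b (W w)]) = (\sum_(e | b e) fine (P (D `&` [set w | W w = e])))%:E.
Proof.
move=> mD mW.
have mDW e : measurable (D `&` [set w | W w = e]) by exact: measurableI.
suff H (r : seq E) : uniq r ->
    measurable (D `&` [set w | W w \in r]) /\
    P (D `&` [set w | W w \in r]) = (\sum_(e <- r) fine (P (D `&` [set w | W w = e])))%:E.
  have [_] := H (enum b) (enum_uniq b); rewrite big_enum => <-.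
  by congr (P (_ `&` _)); apply/seteqP; split => w /=; rewrite mem_enum.
elim: r => [_|e r IHr /= /andP[er ur]].
  have -> : D `&` [set w | W w \in [::]] = classical_sets.set0.
    by apply/seteqP; split => w //= -[].
  by rewrite measure0 big_nil.
have [mr Pr] := IHr ur.
have -> : D `&` [set w | W w \in e :: r] =
    (D `&` [set w | W w = e]) `|` (D `&` [set w | W w \in r]).
  apply/seteqP; split => w /=; rewrite inE.
    by case=> Dw /orP[/eqP|]; [left|right].
  by case=> -[Dw]; [move=> ->; rewrite eqxx|move=> ->; rewrite orbT].
split; first exact: measurableU.
rewrite measureU //; last first.
  apply/seteqP; split => w //= -[[_ We] [_]]; rewrite We => e_r.
  by rewrite e_r in er.
by rewrite big_cons EFinD fineK ?fin_num_measure // -Pr.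
Qed.

Section trajectory.
Variables (R : realType) (N : nat) (d : measure_display) (Omega : measurableType d).
Variable P : probability Omega R.
Variables (theta : 'I_N -> 'I_N -> {RV P >-> bool}) (X : int -> 'I_N -> {RV P >-> bool}).
Variables (lambda mu p : R) (Pp : {set 'I_N}).
Hypothesis model : is_model theta X lambda mu p Pp.
Let S := {ffun 'I_N -> bool}.

Let measurable_RV (f : {RV P >-> bool}) b : measurable [set w | f w = b].
Proof. by apply: (measurable_funPTI f (Y := [set b])). Qed.

Lemma measurable_theta_event t : measurable (theta_event theta t).
Proof.
have -> : theta_event theta t =
    \bigcap_(ij in [set: 'I_N * 'I_N]) [set w | theta ij.1 ij.2 w = t ij.1 ij.2].
  apply/seteqP; split => [w h [i j] _|w h i j] /=; first exact: h.
  exact: (h (i, j) I).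
by apply: fin_bigcap_measurable => // -[i j] _; exact: measurable_RV.
Qed.

Lemma measurable_path_event s n x : measurable (path_event X s n x).
Proof.
have -> : path_event X s n x =
    \bigcap_(ki in [set: 'I_n * 'I_N]) [set w | X (s + ki.1%:Z) ki.2 w = x ki.1 ki.2].
  apply/seteqP; split => [w h [k i] _|w h k kn i] /=; first exact: h.
  exact: (h (Ordinal kn, i) I).
by apply: fin_bigcap_measurable => // -[k i] _; exact: measurable_RV.
Qed.

Let mass t n x := fine (P (theta_event theta t `&` path_event X 1 n x)).

(** The joint mass of [theta = t] and [X_1 = y]. It is not normalized, so null values of [theta]
    require no conditioning. *)
Definition initial_mass t (y : S) := mass t 1 (fun=> y).

Lemma initial_mass_ge0 t y : 0 <= initial_mass t y.
Proof. exact: fine_ge0. Qed.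

Lemma path_mass t n (x : nat -> S) :
  mass t n.+1 x =
  initial_mass t (x 0%N) * \prod_(k < n) transition lambda mu Pp t (x k) (x k.+1).
Proof.
elim: n => [|n IHn].
  rewrite big_ord0 mulr1 /initial_mass /mass; congr (fine (P (_ `&` _))).
  by apply/seteqP; split => w h [|k] // _ i; exact: (h 0%N).
rewrite big_ord_recr /= mulrA -IHn /mass (X_markov model) fineM //.
by rewrite fin_num_measure //; apply: measurableI;
  [exact: measurable_theta_event|exact: measurable_path_event].
Qed.

Lemma initial_mass_sum t :
  \sum_y initial_mass t y = \prod_(i < N) \prod_(j < N) bernoulli_pmf p (t i j).
Proof.
apply: EFin_inj; rewrite -(theta_iid_bernoulli model).
pose W w : S := [ffun i => X 1 i w].
have WE y : [set w | W w = y] = path_event X 1 1 (fun=> y).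
  apply/seteqP; split => w /=.
    by move=> <- [|k] // _ i; rewrite ffunE addr0.
  by move=> h; apply/ffunP => i; rewrite ffunE -(h 0%N) // addr0.
have := @probability_preimage_sum R d Omega P S W (theta_event theta t) xpredT
  (measurable_theta_event t).
rewrite (_ : [set w | true] = setT); last by apply/seteqP; split.
rewrite setIT => ->; last by move=> y; rewrite WE; exact: measurable_path_event.
by congr (_%:E); apply: eq_bigr => y _; rewrite WE.
Qed.

(** An event decided by [theta] and [X_1, ..., X_(T+1)] is a finite disjoint union of path events,
    whose masses are given by [path_mass]. *)
Lemma probability_trajectory T (b : pred ('M[bool]_N * {ffun 'I_T.+1 -> S})) :
  P [set w | b (\matrix_(i, j) theta i j w,
                [ffun k : 'I_T.+1 => [ffun i => X (1 + k%:Z) i w]])] =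
  (\sum_(e | b e) initial_mass e.1 (e.2 ord0) *
     \prod_(k < T) transition lambda mu Pp e.1 (e.2 (inord k)) (e.2 (inord k.+1)))%:E.
Proof.
pose W w := (\matrix_(i, j) theta i j w,
  [ffun k : 'I_T.+1 => [ffun i => X (1 + k%:Z) i w] : S]).
have WE e : [set w | W w = e] =
    theta_event theta e.1 `&` path_event X 1 T.+1 (fun k => e.2 (inord k)).
  case: e => t f; apply/seteqP; split => w /=.
    case=> <- <-; split => [i j|k kT i]; first by rewrite mxE.
    by rewrite !ffunE inordK.
  case=> h1 h2; congr pair; first by apply/matrixP => i j; rewrite mxE.
  by apply/ffunP => k; apply/ffunP => i; rewrite !ffunE h2 // inord_val.
have mW e : measurable [set w | W w = e].
  rewrite WE; apply: measurableI;
    [exact: measurable_theta_event|exact: measurable_path_event].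
have := @probability_preimage_sum R d Omega P _ W setT b measurableT mW.
rewrite setTI => ->; congr (_%:E); apply: eq_bigr => e _.
rewrite setTI WE; have := @path_mass e.1 T (fun k => e.2 (inord k)).
rewrite /mass => ->; congr (initial_mass _ (e.2 _) * _).
by apply: val_inj; rewrite /= inordK.
Qed.

End trajectory.

(** * Rates and conclusion *)

(** Both factors are fractions with denominator at most 2. The first numerator is at least
    [L * p * kappa]; the second is [1 - mu - L * p * rP], at least [L * rM] because [mu <= lambda].
    The bound is thus uniform in [mu]. *)
Lemma limit_mean_variance_ge (R : realType) (N : nat) (lambda mu p kappa : R)
    (Pp : {set 'I_N}) :
  (0 < N)%N -> 0 < lambda < 1 -> 0 < mu <= lambda -> 0 < p <= 1 -> 0 < kappa ->
  kappa * N%:R <= #|Pp|%:R -> kappa * N%:R <= #|~: Pp|%:R ->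
  ((1 - lambda) * p * kappa / 2) * ((1 - lambda) * kappa / 2)
  <= limit_mean lambda mu p Pp * (1 - limit_mean lambda mu p Pp).
Proof.
move=> N0 /andP[l0 l1] /andP[m0 ml] /andP[p0 p1] k0 kP kM.
have N0' : 0 < N%:R :> R by rewrite ltr0n.
have cN := card_setC_natr R Pp.
rewrite /limit_mean.
set rP := #|Pp|%:R / N%:R; set rM := #|~: Pp|%:R / N%:R.
set L := 1 - lambda.
have L0 : 0 < L by rewrite subr_gt0.
have rP1 : rP + rM = 1 by rewrite /rP /rM -mulrDl cN divff // gt_eqF.
have hP : kappa <= rP by rewrite ler_pdivlMr.
have hM : kappa <= rM by rewrite ler_pdivlMr.
set rho := p * (rP - rM).
have pP0 : 0 <= p * rP by rewrite mulr_ge0 // ?(ltW p0) //; lra.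
have pM0 : 0 <= p * rM by rewrite mulr_ge0 // ?(ltW p0) //; lra.
have pP : p * rP <= rP by rewrite ler_piMl //; lra.
have pM : p * rM <= rM by rewrite ler_piMl //; lra.
have Lrho : `|L * rho| <= 1.
  rewrite normrM (gtr0_norm L0) mulr_ile1 ?(ltW L0) //; first by rewrite /L; lra.
  by rewrite /rho mulrBr ler_norml; apply/andP; split; lra.
have /andP[Lr1 Lr2] : -1 <= L * rho <= 1 by rewrite -ler_norml.
have LpP : L * (p * rP) <= L * rP by rewrite ler_pM2l.
have kM' : L * kappa <= L * rM by rewrite ler_pM2l.
have kPM : L * p * kappa <= L * p * rM by rewrite ler_pM2l // mulr_gt0.
have Lk0 : 0 < L * kappa by rewrite mulr_gt0.
have Lpk0 : 0 < L * p * kappa by rewrite !mulr_gt0.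
have rhoE : L * rho = L * (p * rP) - L * p * rM by rewrite /rho; ring.
have rPE : L * rP = L - L * rM by apply/eqP; rewrite eq_sym subr_eq -mulrDr rP1 mulr1.
have LE : L = 1 - lambda by [].
have den0 : 0 < 1 - L * rho.
  rewrite rhoE; lra.
have -> : 1 - (mu + L * p * rM) / (1 - L * rho) =
    (1 - L * rho - (mu + L * p * rM)) / (1 - L * rho) by field; rewrite gt_eqF.
apply: ler_pM; rewrite ?divr_ge0 ?(ltW Lk0) ?(ltW Lpk0) //.
  rewrite ler_pdivlMr // mulrAC ler_pdivrMr //.
  by apply: (@le_trans _ _ (L * p * kappa * 2)); [rewrite ler_pM2l //|]; lra.
rewrite ler_pdivlMr // mulrAC ler_pdivrMr //.
by apply: (@le_trans _ _ (L * kappa * 2)); [rewrite ler_pM2l //|]; lra.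
Qed.

(** With exponent [x = delta ^+ 2 * N / 8], the inequality [x ^+ 2 / 4 <= expR x] absorbs the factor
    [N] of the union bound and leaves order [1 / N]. *)
Lemma theta_rate (R : realType) (N : nat) (delta : R) :
  (0 < N)%N -> 0 < delta ->
  8 * N%:R * expR (- ((delta * N%:R) ^+ 2 / (8 * N%:R))) <= (8 / delta) ^+ 4 * N%:R^-1.
Proof.
move=> N0 d0; have N0' : 0 < N%:R :> R by rewrite ltr0n.
have -> : (delta * N%:R) ^+ 2 / (8 * N%:R) = delta ^+ 2 * N%:R / 8 by field; rewrite gt_eqF.
set x := delta ^+ 2 * N%:R / 8.
have x0 : 0 < x by rewrite divr_gt0 // mulr_gt0 // exprn_gt0.
have h : x ^+ 2 / 4 <= expR x.
  have -> : x ^+ 2 / 4 = (x / 2) ^+ 2 by field.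
  have -> : expR x = expR (x / 2) ^+ 2 by rewrite -expRM_natl; congr expR; field.
  have x2 : 0 <= x / 2 by lra.
  rewrite lerXn2r ?nnegrE ?expR_ge0 //.
  by apply: le_trans (expR_ge1Dx _); rewrite lerDr.
apply: (@le_trans _ _ (8 * N%:R * (x ^+ 2 / 4)^-1)).
  rewrite expRN ler_pM2l ?mulr_gt0 // lef_pV2 ?posrE ?expR_gt0 //.
  by rewrite divr_gt0 // exprn_gt0.
have -> : 8 * N%:R * (x ^+ 2 / 4)^-1 = (8 / delta) ^+ 4 * N%:R^-1 / 2.
  by rewrite /x; field; rewrite !gt_eqF.
have : 0 <= (8 / delta) ^+ 4 * N%:R^-1.
  by rewrite mulr_ge0 ?exprn_ge0 ?invr_ge0 ?divr_ge0 // ltW.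
lra.
Qed.

Lemma ln_ge_half (R : realType) (x : R) : 2 <= x -> 1 / 2 <= ln x.
Proof.
move=> x2; apply: (@le_trans _ _ (ln 2)); last by rewrite ler_ln ?posrE //; lra.
rewrite -[leLHS]expRK ler_ln ?posrE ?expR_gt0 //.
have h := @expR_ge1Dx R (- (1 / 2)); rewrite expRN in h.
have e0 := @expR_gt0 R (1 / 2).
rewrite -(@ler_pM2r _ (expR (1 / 2))^-1) ?invr_gt0 // divff ?gt_eqF //; lra.
Qed.

(** With [l = ln (T * N) >= 1 / 2], the exponent [e ^+ 2 * T / (8 * N ^+ 2)] is at least
    [4 * l ^+ 2 >= 2 * l], so the exponential is at most [(T * N) ^- 2]; this cancels the [N ^+ 2]
    of the union bound. *)
Lemma trajectory_rate (R : realType) (N T : nat) (e : R) :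
  (1 < N)%N -> (0 < T)%N -> 0 < e <= 1 ->
  32 / e ^+ 2 * N%:R ^+ 2 * ln ((T * N)%N%:R) ^+ 2 <= T%:R ->
  N%:R <= e * T%:R /\
  6 * N%:R ^+ 2 * expR (- ((e / N%:R * T%:R) ^+ 2 / (8 * T%:R))) <= 6 * T%:R^-1.
Proof.
move=> N1 T0 /andP[e0 e1] hT.
have N2 : 2 <= N%:R :> R by rewrite (ler_nat R 2).
have T1 : 1 <= T%:R :> R by rewrite ler1n.
have N0' : 0 < N%:R :> R by lra.
have T0' : 0 < T%:R :> R by lra.
have TN2 : 2 <= (T * N)%N%:R :> R.
  by rewrite natrM; apply: (le_trans N2); rewrite ler_peMl // ltW.
have lh := ln_ge_half TN2.
set l := ln _ in hT lh.
have hT' : 32 * N%:R ^+ 2 * l ^+ 2 <= e ^+ 2 * T%:R.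
  rewrite -(ler_pM2l (_ : 0 < e ^+ 2)) in hT; last by rewrite exprn_gt0.
  apply: le_trans hT; rewrite le_eqVlt; apply/orP; left; apply/eqP; field; rewrite gt_eqF //.
have l2 : 1 / 4 <= l ^+ 2.
  have -> : 1 / 4 = (1 / 2) ^+ 2 :> R by field.
  by rewrite lerXn2r ?nnegrE //; lra.
have N2' : 0 <= N%:R ^+ 2 :> R by rewrite sqr_ge0.
split.
  have h1 : N%:R ^+ 2 * (1 / 4) <= N%:R ^+ 2 * l ^+ 2 by rewrite ler_wpM2l.
  have h2 : N%:R * 2 <= N%:R ^+ 2 :> R by rewrite expr2 ler_pM2l.
  have h3 : e ^+ 2 * T%:R <= e * T%:R.
    by rewrite ler_pM2r // expr2 ler_piMl // ltW.
  lra.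
have hx : 2 * l <= (e / N%:R * T%:R) ^+ 2 / (8 * T%:R).
  have -> : (e / N%:R * T%:R) ^+ 2 / (8 * T%:R) = e ^+ 2 * T%:R / (8 * N%:R ^+ 2).
    by field; rewrite !gt_eqF.
  rewrite ler_pdivlMr ?mulr_gt0 ?exprn_gt0 //.
  have h1 : l * (1 / 2) <= l ^+ 2 by rewrite expr2 ler_pM2l //; lra.
  have h2 : N%:R ^+ 2 * (l * (1 / 2)) <= N%:R ^+ 2 * l ^+ 2 by rewrite ler_wpM2l.
  lra.
have ll : expR l = T%:R * N%:R.
  by rewrite /l lnK ?natrM // posrE mulr_gt0.
apply: (@le_trans _ _ (6 * N%:R ^+ 2 * expR (- (2 * l)))).
  by rewrite ler_wpM2l ?mulr_ge0 // ler_expR lerN2.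
have -> : expR (- (2 * l)) = ((T%:R * N%:R) ^+ 2)^-1.
  by rewrite expRN -ll -expRM_natl.
have -> : 6 * N%:R ^+ 2 * ((T%:R * N%:R) ^+ 2)^-1 = 6 * (T%:R^-1 * T%:R^-1) :> R.
  by field; rewrite !gt_eqF.
by rewrite ler_pM2l // ler_piMr ?invr_ge0 ?(ltW T0') // invf_le1.
Qed.

(** A union bound over [4 * N] half sums and [N + 2 * N ^+ 2 <= 3 * N ^+ 2] martingales, each with a
    two-sided tail of prefactor 2. *)
Lemma failure_probability_le (R : realType) (N T : nat) (d : measure_display)
    (Omega : measurableType d) (P : probability Omega R)
    (theta : 'I_N -> 'I_N -> {RV P >-> bool}) (X : int -> 'I_N -> {RV P >-> bool})
    (lambda mu p : R) (Pp : {set 'I_N}) (e delta : R)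
    (b : pred ('M[bool]_N * {ffun 'I_T.+1 -> {ffun 'I_N -> bool}})) :
  is_model theta X lambda mu p Pp ->
  (0 < N)%N -> (0 < T)%N -> 0 <= lambda <= 1 -> 0 <= mu <= lambda -> 0 <= p <= 1 ->
  0 <= e <= 1 -> 0 <= delta <= 1 ->
  (forall t (f : {ffun 'I_T.+1 -> {ffun 'I_N -> bool}}),
     (forall c, `|half_sum_dev p Pp t c| <= delta * N%:R) ->
     (forall c, `|\sum_(k < T) increment lambda mu Pp t c (f (inord k)) (f (inord k.+1))|
                <= e / N%:R * T%:R) ->
     ~~ b (t, f)) ->
  (P [set w | b (\matrix_(i, j) theta i j w,
                 [ffun k : 'I_T.+1 => [ffun i => X (1 + k%:Z)%R i w]])]
   <= (8 * N%:R * expR (- ((delta * N%:R) ^+ 2 / (8 * N%:R))) +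
       6 * N%:R ^+ 2 * expR (- ((e / N%:R * T%:R) ^+ 2 / (8 * T%:R))))%:E)%E.
Proof.
move=> model N0 T0 hl hm hp /andP[e0 e1] /andP[d0 d1] hb.
have N0' : 0 < N%:R :> R by rewrite ltr0n.
have N1 : 1 <= N%:R :> R by rewrite ler1n.
have T0' : 0 < T%:R :> R by rewrite ltr0n.
rewrite (probability_trajectory model) lee_fin.
pose wt t (f : {ffun 'I_T.+1 -> {ffun 'I_N -> bool}}) : R := initial_mass theta X t (f ord0) *
  \prod_(k < T) transition lambda mu Pp t (f (inord k)) (f (inord k.+1)).
pose law (t : 'M[bool]_N) : R := \prod_(i < N) \prod_(j < N) bernoulli_pmf p (t i j).
have wt0 t f : 0 <= wt t f.
  rewrite mulr_ge0 ?initial_mass_ge0 // prodr_ge0 // => k _; exact: transition_ge0.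
have init_sum t : \sum_x initial_mass theta X t x = law t by exact: initial_mass_sum model t.
have wt_sum t : \sum_f wt t f <= law t.
  rewrite -init_sum -[leRHS]mulr1 -(expr1n _ T); apply: path_sum_le => //.
  - by move=> x; exact: initial_mass_ge0.
  - by move=> x y; exact: transition_ge0.
  - by move=> x; rewrite transition_sum1.
pose bad_theta (c : bool * bool * 'I_N) (t : 'M[bool]_N) :=
  delta * N%:R <= `|half_sum_dev p Pp t c|.
pose bad_traj c (t : 'M[bool]_N) (f : {ffun 'I_T.+1 -> {ffun 'I_N -> bool}}) := e / N%:R * T%:R <=
  `|\sum_(k < T) increment lambda mu Pp t c (f (inord k)) (f (inord k.+1))|.
have theta_part c : \sum_(x : 'M[bool]_N * {ffun 'I_T.+1 -> {ffun 'I_N -> bool}} | bad_theta c x.1) wt x.1 x.2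
    <= 2 * expR (- ((delta * N%:R) ^+ 2 / (8 * N%:R))).
  have -> : \sum_(x : 'M[bool]_N * {ffun 'I_T.+1 -> {ffun 'I_N -> bool}} | bad_theta c x.1) wt x.1 x.2 =
      \sum_(t | bad_theta c t) \sum_f wt t f.
    by rewrite pair_big_dep; apply: eq_bigl => x; rewrite andbT.
  (* The trajectory is summed out, which leaves the law of [theta]. *)
  apply: (@le_trans _ _ (\sum_(t | bad_theta c t) law t)).
    by apply: ler_sum => t _; exact: wt_sum.
  pose phi j := if c.1.1 then (c.2, j) else (j, c.2).
  have phi_inj : injective phi by move=> j k; rewrite /phi; case: c.1.1 => -[].
  have dN : 0 <= delta * N%:R <= 2 * N%:R.
    by rewrite mulr_ge0 //= ler_pM2r //; lra.
  apply: le_trans (theta_tail (if c.1.2 then Pp else ~: Pp) hp phi_inj N0 dN).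
  rewrite le_eqVlt; apply/orP; left; apply/eqP; apply: eq_bigl => t.
  rewrite /bad_theta /half_sum_dev; congr (_ <= `|_|).
  by apply: eq_bigr => j _; rewrite /phi; case: c.1.1.
have traj_part c : \sum_(x : 'M[bool]_N * {ffun 'I_T.+1 -> {ffun 'I_N -> bool}} | bad_traj c x.1 x.2) wt x.1 x.2
    <= 2 * expR (- ((e / N%:R * T%:R) ^+ 2 / (8 * T%:R))).
  have -> : \sum_(x : 'M[bool]_N * {ffun 'I_T.+1 -> {ffun 'I_N -> bool}} | bad_traj c x.1 x.2) wt x.1 x.2 =
      \sum_t \sum_(f | bad_traj c t f) wt t f.
    by rewrite pair_big_dep.
  (* The martingale tail is applied for each fixed [t], with total mass [law t]; these masses sum to
     1. *)
  apply: (@le_trans _ _ (\sum_t 2 * law t *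
      expR (- ((e / N%:R * T%:R) ^+ 2 / (8 * T%:R))))); last first.
    by rewrite -mulr_suml -mulr_sumr matrix_bernoulli_sum1 mulr1.
  apply: ler_sum => t _; rewrite -init_sum.
  apply: (markov_path_tail (h := increment lambda mu Pp t c)) => //.
  - by move=> x; exact: initial_mass_ge0.
  - by move=> x y; exact: transition_ge0.
  - by move=> x; rewrite transition_sum1.
  - by move=> x; exact: increment_centered.
  - by move=> x y; exact: increment_le1.
  - rewrite mulr_ge0 ?divr_ge0 //= ler_pM2r // ler_pdivrMr //; lra.
pose bad (c : (bool * bool * 'I_N) + ('I_N + ('I_N * 'I_N + 'I_N * 'I_N)))
    (x : 'M[bool]_N * {ffun 'I_T.+1 -> {ffun 'I_N -> bool}}) :=
  match c with inl c => bad_theta c x.1 | inr c => bad_traj c x.1 x.2 end.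
apply: le_trans (@sum_union_le R _ _ (fun x => wt x.1 x.2) b bad _ _) _ => //.
  move=> [t f] bx; apply: contrapT => nbad.
  have := hb t f; rewrite bx => /(_ _ _)/negP; apply => // c; rewrite leNgt; apply/negP => lt.
    by apply: nbad; exists (inl c); exact: ltW.
  by apply: nbad; exists (inr c); exact: ltW.
rewrite big_sumType /= lerD //.
  apply: le_trans (ler_sum _ (fun c _ => theta_part c)) _.
  rewrite sumr_const !card_prod card_bool card_ord -[leLHS]mulr_natl !natrM.
  by rewrite le_eqVlt; apply/orP; left; apply/eqP; ring.
apply: le_trans (ler_sum _ (fun c _ => traj_part c)) _.
rewrite sumr_const !card_sum !card_prod card_ord -[leLHS]mulr_natl mulrA.
rewrite ler_wpM2r ?expR_ge0 // !natrD !natrM.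
have : N%:R <= N%:R ^+ 2 :> R by rewrite expr2 ler_peMl.
lra.
Qed.

Lemma eq_sigma_ag (R : realType) (N T : nat) (Y Y' : nat -> 'cV[R]_N) :
  (forall n, (0 < n <= T.+1)%N -> Y n = Y' n) -> sigma_ag Y T = sigma_ag Y' T.
Proof.
move=> YY'.
have Em : mhat Y T = mhat Y' T.
  rewrite /mhat; congr (_ *: _); apply: eq_big_nat => n /andP[n0 nT].
  by rewrite YY' // n0 ltnW.
rewrite /sigma_ag /Sigma1hat Em; congr ((_ *: _)^T *m _).
apply: eq_big_nat => n /andP[n0 nT]; rewrite !YY' //; apply/andP; split => //.
exact: ltnW.
Qed.

(** Treats both clusterings at once: [out] only has to recover the communities from any vector close
    to a two-level profile. The choice [e = delta / 6] meets [6 * e <= delta]. *)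
Lemma misclassification_probability_le (R : realType) (N T : nat)
    (d : measure_display) (Omega : measurableType d) (P : probability Omega R)
    (theta : 'I_N -> 'I_N -> {RV P >-> bool}) (X : int -> 'I_N -> {RV P >-> bool})
    (lambda mu p delta : R) (Pp : {set 'I_N})
    (out : 'cV[R]_N -> {set 'I_N} * {set 'I_N}) :
  is_model theta X lambda mu p Pp ->
  (1 < N)%N -> (0 < T)%N -> 0 < lambda < 1 -> 0 < mu <= lambda -> 0 < p <= 1 ->
  0 < delta <= 1 -> 3 <= lambda * delta * N%:R ->
  32 / (delta / 6) ^+ 2 * N%:R ^+ 2 * ln ((T * N)%N%:R) ^+ 2 <= T%:R ->
  (forall (v : 'cV[R]_N) b, (forall i, `|v i 0 - b - (1 - lambda) *
      (p * (limit_mean lambda mu p Pp * (1 - limit_mean lambda mu p Pp)))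
      * side R Pp i| <= 31 * delta / lambda ^+ 2) -> out v = (Pp, ~: Pp)) ->
  (P [set w | out (sigma_ag (sample_vector X w) T) <> (Pp, ~: Pp)]
    <= (((8 / delta) ^+ 4 + 6) * (N%:R^-1 + T%:R^-1))%:E)%E.
Proof.
move=> model N1 T0 hl hm hp hd N_large hT hout.
have N0 : (0 < N)%N by apply: ltnW.
have /andP[l0 l1] := hl; have /andP[m0 m1] := hm; have /andP[p0 p1] := hp.
have /andP[d0 d1] := hd.
have he : 0 < delta / 6 <= 1 by apply/andP; split; lra.
have [eT rateT] := trajectory_rate N1 T0 he hT.
have rateN := theta_rate N0 d0.
pose Y (f : {ffun 'I_T.+1 -> {ffun 'I_N -> bool}}) (n : nat) : 'cV[R]_N :=
  \col_i (f (inord n.-1) i)%:R.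
pose b (x : 'M[bool]_N * {ffun 'I_T.+1 -> {ffun 'I_N -> bool}}) :=
  out (sigma_ag (Y x.2) T) != (Pp, ~: Pp).
have -> : [set w | out (sigma_ag (sample_vector X w) T) <> (Pp, ~: Pp)] =
    [set w | b (\matrix_(i, j) theta i j w,
                [ffun k : 'I_T.+1 => [ffun i => X (1 + k%:Z) i w]])].
  have E w : sigma_ag (sample_vector X w) T =
      sigma_ag (Y [ffun k : 'I_T.+1 => [ffun i => X (1 + k%:Z) i w]]) T.
    apply: eq_sigma_ag => -[//|n] /= nT; apply/colP => i.
    by rewrite !mxE !ffunE inordK.
  by apply/seteqP; split => w /=; rewrite /b /= E => /eqP.
have he' : 0 <= delta / 6 <= 1 by apply/andP; split; lra.
apply: (le_trans (@failure_probability_le _ _ _ _ _ _ _ _ _ _ _ _ (delta / 6) delta b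
  model N0 T0 _ _ _ he' _ _)); rewrite ?(ltW l0) ?(ltW l1) ?(ltW m0) ?(ltW p0) ?(ltW d0) //.
  move=> t f hsum hinc; rewrite /b /=; apply/negPn/eqP.
  have p01 : 0 <= p <= 1 by rewrite (ltW p0).
  have ed : 6 * (delta / 6) <= delta by lra.
  have [c hc] := @sigma_ag_profile R N T lambda mu p Pp t (fun k => f (inord k)) N0 T0
    hl hm _ _ eT hinc p01 hd ed N_large hsum.
  exact: hout hc.
rewrite lee_fin.
have iN : 0 <= N%:R^-1 :> R by rewrite invr_ge0.
have iT : 0 <= T%:R^-1 :> R by rewrite invr_ge0.
have d4 : 0 <= (8 / delta) ^+ 4 by rewrite exprn_ge0 // divr_ge0 // ltW.
have := mulr_ge0 d4 iT; lra.
Qed.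

Theorem corollary2p7 (R : realType) (K0 lambda p rp rm : R) :
  0 < lambda < 1 -> 0 < p <= 1 ->
  0 < rp < 1 -> 0 < rm < 1 -> rp + rm = 1 ->
  exists (N0 : nat) (K1 K2 : R), [/\ 0 < K1, 0 < K2 &
    forall (mu : R), 0 < mu <= lambda ->
    forall (N T : nat), (0 < N)%N -> (0 < T)%N -> (N0 <= N)%N ->
      K1 * N%:R ^+ 2 * ln ((T * N)%N%:R) ^+ 2 <= T%:R ->
    forall (Pp : {set 'I_N}),
      Num.max `|#|Pp|%:R / N%:R - rp| `|#|~: Pp|%:R / N%:R - rm|
        <= K0 / N%:R ->
    forall (d : measure_display) (Omega : measurableType d)
      (P : probability Omega R)
      (theta : 'I_N -> 'I_N -> {RV P >-> bool})
      (X : int -> 'I_N -> {RV P >-> bool}),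
      is_model theta X lambda mu p Pp ->
    (forall two_means : 'cV[R]_N -> {set 'I_N} * {set 'I_N},
      (forall v, is_2means v (two_means v)) ->
      (P [set w | two_means (sigma_ag (sample_vector X w) T) <> (Pp, ~: Pp)]
         <= (K2 * (N%:R^-1 + T%:R^-1))%:E)%E) /\
    (P [set w | mean_threshold (sigma_ag (sample_vector X w) T) <> (Pp, ~: Pp)]
       <= (K2 * (N%:R^-1 + T%:R^-1))%:E)%E].
Proof.
move=> hl hp /andP[rp0 rp1] /andP[rm0 rm1] rpm.
have /andP[l0 l1] := hl; have /andP[p0 p1] := hp.
pose L := 1 - lambda.
have L0 : 0 < L by rewrite subr_gt0.
(* Half of the smaller limiting fraction, divided by 1: the slack [kappa] between [2 * kappa] and
   [kappa] absorbs [K0 / N]. *)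
have [kappa [k0 krp krm]] : exists kappa, [/\ 0 < kappa, 2 * kappa <= rp & 2 * kappa <= rm].
  have h : 2 * (Num.min rp rm / 2) = Num.min rp rm by rewrite mulrC divfK.
  exists (Num.min rp rm / 2); rewrite h divr_gt0 ?lt_min ?rp0 //.
  by rewrite !ge_min !lexx orbT.
(* A lower bound on the half gap between the two levels that is free of [mu], [N] and [Pp], so that
   the final constants are too. *)
have [g0 g00 g0_le] : exists2 g0, 0 < g0 & forall (mu : R) (N : nat) (Pp : {set 'I_N}),
    (0 < N)%N -> 0 < mu <= lambda ->
    kappa * N%:R <= #|Pp|%:R -> kappa * N%:R <= #|~: Pp|%:R ->
    g0 <= L * (p * (limit_mean lambda mu p Pp * (1 - limit_mean lambda mu p Pp))).
  exists (L * (p * ((L * p * kappa / 2) * (L * kappa / 2)))).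
    by rewrite !mulr_gt0 ?invr_gt0.
  move=> mu N Pp N0 hm kP kM; rewrite !ler_pM2l //; exact: limit_mean_variance_ge.
have lam20 : 0 < lambda ^+ 2 by rewrite exprn_gt0.
have kg0 : 0 < kappa * g0 by rewrite mulr_gt0.
have [delta [d0 d1 eta8]] : exists delta,
    [/\ 0 < delta, delta <= 1 & 8 * (31 * delta / lambda ^+ 2) <= kappa * g0].
  (* Here [248 = 8 * 31]: the profile error becomes the tolerance of [two_means_separated]. *)
  exists (Num.min 1 (kappa * g0 * lambda ^+ 2 / 248)).
  set delta := Num.min _ _; split.
  - by rewrite lt_min ltr01 divr_gt0 // mulr_gt0.
  - by rewrite ge_min lexx.
  have h : delta <= kappa * g0 * lambda ^+ 2 / 248 by rewrite ge_min lexx orbT.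
  rewrite -(ler_pM2r lam20).
  have -> : 8 * (31 * delta / lambda ^+ 2) * lambda ^+ 2 = 248 * delta.
    by field; rewrite gt_eqF.
  by rewrite mulrC -ler_pdivlMr // ltr0n.
(* The three terms ensure [N >= 2], [3 <= lambda * delta * N] and [K0 / N <= kappa]. *)
pose N0 := (2 + Num.bound (3 / (lambda * delta)) + Num.bound (`|K0| / kappa))%N.
exists N0, (32 / (delta / 6) ^+ 2), ((8 / delta) ^+ 4 + 6); split.
- by rewrite divr_gt0 // exprn_gt0 // divr_gt0.
- by rewrite addr_gt0 // exprn_gt0 // divr_gt0.
move=> mu hm N T N_pos T_pos NN0 hT Pp hmax d Omega P theta X model.
have NR0 : 0 < N%:R :> R by rewrite ltr0n.
have N1 : (1 < N)%N by apply: leq_trans NN0; rewrite /N0 -addnA.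
have ld0 : 0 < lambda * delta by rewrite mulr_gt0.
have N_large : 3 <= lambda * delta * N%:R.
  rewrite mulrC -ler_pdivrMr //.
  apply: le_trans (ltW (archi_boundP _)) _; first by rewrite divr_ge0 // ltW.
  by rewrite ler_nat; apply: leq_trans NN0; rewrite /N0 addnAC leq_addl.
have K0N : K0 <= kappa * N%:R.
  rewrite mulrC -ler_pdivrMr //; apply: (@le_trans _ _ (`|K0| / kappa)).
    by rewrite ler_pM2r ?invr_gt0 // ler_norm.
  apply: le_trans (ltW (archi_boundP _)) _; first by rewrite divr_ge0 // ltW.
  by rewrite ler_nat; apply: leq_trans NN0; rewrite /N0 leq_addl.
have K0N' : K0 / N%:R <= kappa by rewrite ler_pdivrMr.
have [kP kM] : kappa * N%:R <= #|Pp|%:R /\ kappa * N%:R <= #|~: Pp|%:R.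
  move: hmax; rewrite ge_max !ler_norml => /andP[/andP[? ?] /andP[? ?]].
  by split; rewrite -ler_pdivlMr //; lra.
set g := L * (p * (limit_mean lambda mu p Pp * (1 - limit_mean lambda mu p Pp))).
have gg0 : g0 <= g by exact: g0_le.
have g_pos : 0 < g by exact: lt_le_trans gg0.
have kg : kappa * g0 <= kappa * g by rewrite ler_pM2l.
have hd : 0 < delta <= 1 by rewrite d0.
split=> [two_means h2|];
  apply: (misclassification_probability_le model N1 T_pos hl hm hp hd N_large hT) => v b hv.
  apply: (two_means_separated N_pos (h2 v) hv kP kM k0 g_pos).
  exact: le_trans kg.
apply: (mean_threshold_separated N_pos hv kP kM g_pos).
(* The threshold rule needs only [eta < kappa * g], which follows from [8 * eta <= kappa * g] and
   [eta > 0]. *)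
apply: lt_le_trans (le_trans eta8 kg); rewrite -[ltLHS]mul1r ltr_pM2r ?ltr1n //.
by rewrite divr_gt0 // mulr_gt0.
Qed.
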